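(* Assume the setting below and let $\lambda\in\mathbb C\setminus\sigma_{\mathrm{ess}}(\mathcal L)$. Suppose $\boldsymbol\psi\in C^1(\mathbb R,\mathbb R^2)$, that $\boldsymbol\psi$ and $\boldsymbol\psi_x$ decay exponentially as $|x|\to\infty$, and that $\det(\mathbf M(x))\neq0$ for all $x\in\mathbb R$. Then the kernel $\mathbf K(\cdot,\cdot;\lambda)$ is globally Lipschitz-continuous on $\mathbb R\times\mathbb R$.
   Context: Setting. Real parameters $D,\beta,\delta,\alpha,\epsilon,\gamma,\mu,\nu$ with $\beta\ge0$, $(D,\beta)\ne(0,0)$; $\mathbf B=\begin{bmatrix}\beta&-D/2\\ D/2&\beta\end{bmatrix}$, $\mathbf N_0=\begin{bmatrix}\delta&-\alpha\\ \alpha&\delta\end{bmatrix}$, $\mathbf N_1=\begin{bmatrix}\epsilon&-\gamma\\ \gamma&\epsilon\end{bmatrix}$, $\mathbf N_2=\begin{bmatrix}\mu&-\nu\\ \nu&\mu\end{bmatrix}$; $\psi$ a stationary pulse of the cubic–quintic CGLE $i\Psi_t+\frac D2\Psi_{xx}+\gamma|\Psi|^2\Psi+\nu|\Psi|^4\Psi=i\delta\Psi+i\epsilon|\Psi|^2\Psi+i\beta\Psi_{xx}+i\mu|\Psi|^4\Psi$ ($\Psi=e^{-i\alpha t}\psi(x)$), $\boldsymbol\psi=[\operatorname{Re}\psi\ \operatorname{Im}\psi]^T$, $|\boldsymbol\psi|=\|\boldsymbol\psi(x)\|_2$; $\mathbf M(x)=\mathbf N_1|\boldsymbol\psi|^2+\mathbf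 N_2|\boldsymbol\psi|^4+(2\mathbf N_1+4\mathbf N_2|\boldsymbol\psi|^2)\boldsymbol\psi\boldsymbol\psi^T$; $\mathcal L=\mathbf B\partial_x^2+\mathbf N_0+\mathbf M$, $\sigma_{\mathrm{ess}}(\mathcal L)=\{(\delta\pm i\alpha)-s^2(\beta\pm iD/2):s\in\mathbb R\}$. $\mathbf R_\ell=\begin{bmatrix}\mathbf 0&\mathbf 0\\ -\mathbf B^{-1}\mathbf M|\mathbf M|^{-1/2}&\mathbf 0\end{bmatrix}$, $\mathbf R_r=\begin{bmatrix}|\mathbf M|^{1/2}&\mathbf 0\\ \mathbf 0&\mathbf 0\end{bmatrix}$ with $|\mathbf M|=(\mathbf M^*\mathbf M)^{1/2}$. $\mathbf A_\infty(\lambda)=\begin{bmatrix}\mathbf 0&\mathbf I\\ \mathbf B^{-1}(\lambda\mathbf I-\mathbf N_0)&\mathbf 0\end{bmatrix}$, $\mathbf Q(\lambda)$ its stable spectral projection. $\mathbf K(x,y;\lambda)=-\mathbf R_r(x)\mathbf Qe^{\mathbf A_\infty(x-y)}\mathbf Q\mathbf R_\ell(y)$ for $x\ge y$, $\mathbf R_r(x)(\mathbf I-\mathbf Q)e^{\mathbf A_\infty(x-y)}(\mathbf I-\mathbf Q)\mathbf R_\ell(y)$ for $x<y$. *)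

(* Defs.v *)
From HB Require Import structures.
From mathcomp Require Import all_boot all_order all_algebra.
From mathcomp Require Import all_classical all_reals all_analysis.
From mathcomp Require Import complex.
Set Implicit Arguments. Unset Strict Implicit. Unset Printing Implicit Defensive.
Import Order.TTheory GRing.Theory Num.Theory numFieldNormedType.Exports.
Local Open Scope ring_scope.
Local Open Scope classical_set_scope.

Section CGLE.
Variable R : realType.
Local Notation C := (R[i]).

(* real 2x2 matrix  [[a, -b], [b, a]]  (the real form of a + i b) *)
Definition cmat (a b : R) : 'M[R]_2 :=
  \matrix_(i < 2, j < 2) (if i == j then a else if i == 0 then - b else b).

Definition cmx m n (A : 'M[R]_(m, n)) : 'M[C]_(m, n) := map_mx (fun r => r%:C%C) A.

Definition cabs (z : C) : R := Num.sqrt (complex.Re z ^+ 2 + complex.Im z ^+ 2).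

Definition psd (S : 'M[R]_2) : Prop :=
  S^T = S /\ forall v : 'cV[R]_2, 0 <= (v^T *m S *m v) 0 0.
Definition psd_sqrt (P : 'M[R]_2) : 'M[R]_2 :=
  xget 0 [set S | psd S /\ S *m S = P].

Definition mabs (M : 'M[R]_2) : 'M[R]_2 := psd_sqrt (M^T *m M).

Definition expmx_partial n (A : 'M[C]_n.+1) (N : nat) : 'M[C]_n.+1 :=
  \sum_(k < N) ((k`!)%:R^-1 *: A ^+ k).
Definition expmx n (A : 'M[C]_n.+1) : 'M[C]_n.+1 :=
  \matrix_(i, j) ((limn (fun N => complex.Re (expmx_partial A N i j))) +i*
                  (limn (fun N => complex.Im (expmx_partial A N i j))))%C.

Definition gen_eigvec_in n (A : 'M[C]_n.+1) (P : C -> Prop) (w : 'cV[C]_n.+1) :=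
  exists mu : C, P mu /\ (A - mu%:M) ^+ n.+1 *m w = 0.
(* the (direct) sum of the generalized eigenspaces of A for eigenvalues in P
   (at most n.+1 distinct eigenvalues, so n.+1 summands suffice) *)
Definition gen_eigspace n (A : 'M[C]_n.+1) (P : C -> Prop) : set 'cV[C]_n.+1 :=
  [set v | exists w : 'I_n.+1 -> 'cV[C]_n.+1,
      v = \sum_(k < n.+1) w k /\ forall k, gen_eigvec_in A P (w k)].

Definition is_stable_proj n (A Q : 'M[C]_n.+1) : Prop :=
  Q *m Q = Q /\
  (forall v, (Q *m v = v) <-> gen_eigspace A (fun mu => complex.Re mu < 0) v) /\
  (forall v, (Q *m v = 0) <-> gen_eigspace A (fun mu => ~ (complex.Re mu < 0)) v).
Definition stable_proj n (A : 'M[C]_n.+1) : 'M[C]_n.+1 :=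
  xget 0 [set Q | is_stable_proj A Q].

Variables (D beta delta alpha eps gamma mu nu : R).

Definition Bm : 'M[R]_2 := cmat beta (D / 2).
Definition N0 : 'M[R]_2 := cmat delta alpha.
Definition N1 : 'M[R]_2 := cmat eps gamma.
Definition N2 : 'M[R]_2 := cmat mu nu.

Definition sigma_ess : set C :=
  [set lam | exists s : R,
     lam = ((delta +i* alpha) - (s ^+ 2)%:C * (beta +i* (D / 2)))%C \/
     lam = ((delta -i* alpha) - (s ^+ 2)%:C * (beta -i* (D / 2)))%C].

Definition Ainf (lam : C) : 'M[C]_4 :=
  @block_mx C 2 2 2 2 0 1%:M (cmx (invmx Bm) *m (lam%:M - cmx N0)) 0.

Variables (u v : R -> R).   (* psi = [Re psi; Im psi] *)

Definition psi (x : R) : 'cV[R]_2 := \col_(i < 2) (if i == 0 then u x else v x).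
Definition psinorm2 (x : R) : R := u x ^+ 2 + v x ^+ 2.

Definition Mm (x : R) : 'M[R]_2 :=
  psinorm2 x *: N1 + (psinorm2 x ^+ 2) *: N2 +
  (2%:R *: N1 + (4%:R * psinorm2 x) *: N2) *m (psi x *m (psi x)^T).

Definition Rl (x : R) : 'M[C]_4 :=
  @block_mx C 2 2 2 2 0 0
    (cmx (- (invmx Bm *m Mm x *m invmx (psd_sqrt (mabs (Mm x)))))) 0.
Definition Rr (x : R) : 'M[C]_4 :=
  @block_mx C 2 2 2 2 (cmx (psd_sqrt (mabs (Mm x)))) 0 0 0.

Definition Kker (lam : C) (x y : R) : 'M[C]_4 :=
  let Q := stable_proj (Ainf lam) in
  let E := expmx ((x - y)%:C%C *: Ainf lam) in
  if y <= x then - (Rr x *m Q *m E *m Q *m Rl y)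
  else Rr x *m (1 - Q) *m E *m (1 - Q) *m Rl y.

End CGLE.

Section Pulse.
Variable R : realType.
Variables (D beta delta alpha eps gamma mu nu : R) (u v : R -> R).

(* psi is a stationary pulse of the cubic-quintic CGLE, written in real form:
   B psi'' + N0 psi + N1 |psi|^2 psi + N2 |psi|^4 psi = 0
   (this is the equation obtained by inserting Psi = e^{-i alpha t} psi(x)
   and multiplying by -i) *)
Definition pulse_eq : Prop :=
  (forall x, derivable u x 1 /\ derivable v x 1 /\
             derivable (u^`()) x 1 /\ derivable (v^`()) x 1) /\
  forall x,
    Bm D beta *m psi (u^`()^`()) (v^`()^`()) x + N0 delta alpha *m psi u v x
    + psinorm2 u v x *: (N1 eps gamma *m psi u v x)
    + (psinorm2 u v x ^+ 2) *: (N2 mu nu *m psi u v x) = 0.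

End Pulse.

(* Main.v *)
(* [K] has a single nonzero 2x2 block, [S(x) G(x - y) T(y)] with [S = |M|^(1/2)]
   and [T = - B^-1 M |M|^(-1/2)], so it suffices that [S], [G] and [T] are bounded
   and Lipschitz.

   The spatial matrix [[0, I], [W, 0]] is diagonalizable with eigenvalues
   [+- kappa_b], [Re kappa_b > 0], because no eigenvalue of
   [W = B^-1 (lambda - N0)] lies in ]-oo, 0] when [lambda] is outside the essential
   spectrum. The upper right block of the Green's function is
   [G(t) = sum_b exp(- kappa_b |t|) / (2 kappa_b) P_b]: the jump of the full
   Green's function on the diagonal [x = y] does not affect this block.

   Identify R^2 with C. Then [M z = A z + B z^*], where, with [r = |psi|^2],
   [n1 = eps + i gamma], [n2 = mu + i nu],
   [A = r (2 n1 + 3 n2 r)], [B = (n1 + 2 n2 r) psi^2] and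
   [det M = |A|^2 - |B|^2 = r^2 p(r)], [p(r) = 3|n1|^2 + 8 r <n1, n2> + 5 |n2|^2 r^2].
   The square root and the polar factor of [M] are explicit in [A] and [B]. If
   [n1 <> 0] then [p(r(x))] is bounded below by a positive constant (it tends to
   [3|n1|^2] and never vanishes), so [S] is [|psi|] times a bounded Lipschitz
   function, plus [psi^2 / |psi|] times another one. If [n1 = 0] the same holds
   with [|psi|^2] and [psi^2] instead. *)
Require Import Defs.
From HB Require Import structures.
From mathcomp Require Import all_boot all_order all_algebra.
From mathcomp Require Import all_classical all_reals all_analysis.
From mathcomp Require Import complex.
From mathcomp Require Import ring lra.
Import Order.TTheory GRing.Theory Num.Theory numFieldNormedType.Exports.
Import Normc.
Local Open Scope ring_scope.
Local Open Scope classical_set_scope.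

Set Implicit Arguments.
Unset Strict Implicit.
Unset Printing Implicit Defensive.

(** * Algebra of bounded Lipschitz functions *)

Section BoundedLipschitz.
Variables (R : realType) (T : Type) (d : T -> T -> R).
Local Notation C := (R[i]).

(** [d] is an arbitrary function, so that one calculus serves both for [|x - y|] on the line and for
    the sum distance on the plane. No sign is imposed on [K] and [L]. *)
Definition blip (f : T -> C) : Prop := exists K L : R,
  (forall x, normc (f x) <= K) /\ forall x y, normc (f x - f y) <= L * d x y.

Lemma eq_blip (f g : T -> C) : f =1 g -> blip f -> blip g.
Proof. by move=> /funext ->. Qed.

Lemma blip_cst c : blip (fun=> c).
Proof.
by exists (normc c), 0; split=> // x y; rewrite subrr normc0 mul0r.
Qed.

Lemma blipD f g : blip f -> blip g -> blip (fun x => f x + g x).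
Proof.
move=> [K [L [fK fL]]] [K' [L' [gK gL]]]; exists (K + K'), (L + L'); split.
  by move=> x; apply: le_trans (le_normcD _ _) _; exact: lerD.
move=> x y; rewrite mulrDl opprD addrACA.
by apply: le_trans (le_normcD _ _) _; exact: lerD.
Qed.

Lemma normc_ge0 (z : C) : 0 <= normc z.
Proof. by case: z => a b /=; rewrite sqrtr_ge0. Qed.

Lemma blipM f g : blip f -> blip g -> blip (fun x => f x * g x).
Proof.
move=> [K [L [fK fL]]] [K' [L' [gK gL]]].
exists (K * K'), (L * K' + K * L'); split.
  by move=> x; rewrite normcM ler_pM// normc_ge0.
move=> x y.
have -> : f x * g x - f y * g y = (f x - f y) * g x + f y * (g x - g y) by ring.
apply: le_trans (le_normcD _ _) _; rewrite !normcM mulrDl -mulrA.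
rewrite (mulrC K') mulrA -[K * L' * _]mulrA.
by apply: lerD; rewrite ler_pM// normc_ge0.
Qed.

Lemma blip_sum (I : Type) (r : seq I) (P : pred I) (F : I -> T -> C) :
  (forall i, blip (F i)) -> blip (fun x => \sum_(i <- r | P i) F i x).
Proof.
move=> HF; elim: r => [|i r IH].
  by apply: eq_blip (blip_cst 0) => x; rewrite big_nil.
have [Pi|Pi] := boolP (P i).
  by apply: eq_blip (blipD (HF i) IH) => x; rewrite big_cons Pi.
by apply: eq_blip IH => x; rewrite big_cons (negbTE Pi).
Qed.

Lemma normcR (r : R) : normc r%:C%C = `|r|.
Proof. by rewrite /= expr0n addr0 sqrtr_sqr. Qed.

Lemma blip_realP (f : T -> R) (K L : R) :
  (forall x, `|f x| <= K) -> (forall x y, `|f x - f y| <= L * d x y) ->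
  blip (fun x => (f x)%:C%C).
Proof.
move=> fK fL; exists K, L; split=> [x|x y]; first by rewrite normcR.
by rewrite -rmorphB normcR.
Qed.

Lemma blip_ReIm (f : T -> C) :
  blip (fun x => (complex.Re (f x))%:C%C) ->
  blip (fun x => (complex.Im (f x))%:C%C) -> blip f.
Proof.
move=> fr fi.
by apply: eq_blip (blipD fr (blipM (blip_cst 'i%C) fi)) => x; rewrite -complexE.
Qed.

Lemma blipV (f : T -> C) (c : R) :
  0 < c -> (forall x, c <= normc (f x)) -> blip f -> blip (fun x => (f x)^-1).
Proof.
move=> c0 fc [K [L [fK fL]]]; exists c^-1, (L / c ^+ 2); split=> [x|x y].
  by rewrite normcV lef_pV2 ?posrE// (lt_le_trans c0).
have f0 z : f z != 0.
  apply/eqP => fz0; have := fc z.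
  by rewrite fz0 normc0 leNgt c0.
have -> : (f x)^-1 - (f y)^-1 = - ((f x - f y) * (f x)^-1 * (f y)^-1).
  by field; rewrite !f0.
rewrite normcN !normcM !normcV [leRHS]mulrAC -[leLHS]mulrA -invfM.
apply: ler_pM; rewrite ?normc_ge0 ?invr_ge0 ?mulr_ge0 ?normc_ge0//.
rewrite lef_pV2 ?posrE ?exprn_gt0 ?mulr_gt0 ?(lt_le_trans c0)//.
by rewrite expr2 ler_pM// ltW.
Qed.

(** Follows from [a - b = (sqrt a - sqrt b) (sqrt a + sqrt b)], whose second factor is at least
    [2 sqrt c]. *)
Lemma blip_sqrt (f : T -> R) (c : R) : 0 < c -> (forall x, c <= f x) ->
  blip (fun x => (f x)%:C%C) -> blip (fun x => (Num.sqrt (f x))%:C%C).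
Proof.
move=> c0 fc [K [L [fK fL]]].
have f0 x : 0 <= f x by rewrite (le_trans (ltW c0)).
have sc : 0 < Num.sqrt c by rewrite sqrtr_gt0.
apply: (@blip_realP _ (Num.sqrt K) (L / (2 * Num.sqrt c))) => [x|x y].
  rewrite ger0_norm ?sqrtr_ge0// ler_wsqrtr//.
  by have := fK x; rewrite normcR ger0_norm.
have := fL x y; rewrite -rmorphB normcR => H.
rewrite mulrAC ler_pdivlMr ?mulr_gt0//; apply: le_trans H.
have {2}<- := sqr_sqrtr (f0 x); have {2}<- := sqr_sqrtr (f0 y).
rewrite subr_sqr normrM ler_wpM2l//.
rewrite ger0_norm ?addr_ge0 ?sqrtr_ge0// mulr_natl mulr2n.
by rewrite lerD// ler_wsqrtr.
Qed.

Definition mxblip m n (F : T -> 'M[C]_(m, n)) : Prop :=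
  forall i j, blip (fun x => F x i j).

Lemma mxblipM m n p (F : T -> 'M[C]_(m, n)) (G : T -> 'M[C]_(n, p)) :
  mxblip F -> mxblip G -> mxblip (fun x => F x *m G x).
Proof.
move=> HF HG i j.
apply: (@eq_blip (fun x => \sum_k F x i k * G x k j)) => [x|].
  by rewrite mxE.
by apply: blip_sum => k; apply: blipM.
Qed.

End BoundedLipschitz.

Lemma blip_comp (R : realType) (S T : Type) (d : T -> T -> R) (e : S -> S -> R)
    (f : T -> R[i]) (h : S -> T) (k : R) : 0 <= k ->
  (forall x y, 0 <= d x y) ->
  (forall x y, d (h x) (h y) <= k * e x y) -> blip d f -> blip e (f \o h).
Proof.
(* The constant is built from [|L|], as [L] may be negative and [d (h x) (h y)] is only bounded from
   above. *)
move=> k0 d0 de [K [L [fK fL]]]; exists K, (`|L| * k); split=> [x|x y]/=.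
  exact: fK.
apply: le_trans (fL _ _) _; apply: le_trans (ler_norm _) _.
by rewrite normrM -mulrA ler_wpM2l// ger0_norm// de.
Qed.

(** * The complex exponential through real power series *)

Section ComplexExponential.
Variable R : realType.
Local Notation C := (R[i]).
Implicit Types (z w : C) (t : R).

(** The factor [w] lets one real series describe both parts of a complex exponential: [w = 1] gives
    the real part, [w = - 'i] the imaginary part. *)
Definition exp_term z w : R^nat := fun n => complex.Re (w * z ^+ n) / n`!%:R.
(* [Re (w * exp (t * z))], as a power series in the real variable [t] *)
Definition exp_re z w t : R := limn (pseries (exp_term z w) t).
Definition cexp z : C := (exp_re z 1 1 +i* exp_re z (- 'i%C)%R 1)%C.

Lemma normc_ge_re z : `|complex.Re z| <= normc z.
Proof.
by case: z => a b /=; rewrite -sqrtr_sqr ler_wsqrtr// lerDl sqr_ge0.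
Qed.

Lemma normcX z n : normc (z ^+ n) = normc z ^+ n.
Proof.
by elim: n => [|n IH]; rewrite ?expr0 ?normc1// !exprS normcM IH.
Qed.

(** Dominated by [normc w] times the exponential series at [normc z * |t|]. *)
Lemma is_cvg_exp_term z w t : cvgn (pseries (exp_term z w) t).
Proof.
apply: normed_cvg.
pose v n := normc w * exp_coeff (normc z * `|t|) n.
have cv : cvgn (series v).
  rewrite (_ : series v = (fun n => normc w *: series (exp_coeff (normc z * `|t|)) n)).
    by apply: is_cvgZr; exact: is_cvg_series_exp_coeff.
  by apply/funext => n; rewrite /v /series/= scaler_sumr.
apply: series_le_cvg cv => n //=.
  by rewrite /v mulr_ge0 ?normc_ge0 ?exp_coeff_ge0 ?mulr_ge0 ?normc_ge0.
rewrite /v /exp_term /exp_coeff/= !normrM normfV (ger0_norm (ler0n _ _)) normrX.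
rewrite exprMn -!mulrA [_^-1 * _]mulrC !mulrA ler_wpM2r ?invr_ge0 ?ler0n//.
rewrite ler_wpM2r ?exprn_ge0// -normcX -normcM.
exact: normc_ge_re.
Qed.

Lemma exp_re_linear z (a b : R) w1 w2 t :
  exp_re z (a%:C%C * w1 + b%:C%C * w2) t = a * exp_re z w1 t + b * exp_re z w2 t.
Proof.
apply: cvg_lim => //.
rewrite (_ : pseries _ _ = (fun n => a * pseries (exp_term z w1) t n
                                  + b * pseries (exp_term z w2) t n)).
  by apply: cvgD; apply: cvgMr; exact: is_cvg_exp_term.
apply/funext => n; rewrite /pseries /series/= !mulr_sumr -big_split/=.
apply: eq_bigr => k _; rewrite /exp_term mulrDl -!mulrA.
case: (w1 * z ^+ k) => p q; case: (w2 * z ^+ k) => p' q' /=.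
by rewrite !mul0r !subr0; ring.
Qed.

Lemma Re_mul_cexp z w : complex.Re (w * cexp z) = exp_re z w 1.
Proof.
case: w => p q; have -> : (p +i* q)%C = p%:C%C * 1 + (- q)%:C%C * (- 'i%C) :> C.
  by apply/eqP; rewrite eq_complex/= !(mul0r, mulr0, mulr1, subr0, add0r, addr0, mulrN1,
    opprK, oppr0) !eqxx.
rewrite exp_re_linear/=; ring.
Qed.

Lemma exp_re_scale z w t s : exp_re (t%:C%C * z) w s = exp_re z w (t * s).
Proof.
congr (limn _); apply/funext => n; rewrite /pseries /series/=.
apply: eq_bigr => k _; rewrite /exp_term !exprMn -rmorphXn mulrCA.
by case: (w * z ^+ k) => p q /=; rewrite mul0r subr0; ring.
Qed.

Lemma exp_re0 z w : exp_re z w 0 = complex.Re w.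
Proof.
apply: cvg_lim => //; apply: cvg_near_cst; near=> n.
have -> : n = n.-1.+1 by rewrite prednK//; near: n; exact: nbhs_infty_gt.
rewrite /pseries /series/= big_mkord big_ord_recl /= expr0 /exp_term.
rewrite expr0 !mulr1 divr1 big1 ?addr0// => i _.
by rewrite expr0n/= mulr0.
Unshelve. all: by end_near. Qed.

(** Termwise differentiation shifts the coefficients, which amounts to replacing [w] by [w * z]. *)
Lemma is_derive_exp_re z w t : is_derive t (1 : R) (exp_re z w) (exp_re z (w * z) t).
Proof.
have D v : pseries_diffs (exp_term z v) = exp_term z (v * z).
  apply/funext => n; rewrite /pseries_diffs /exp_term exprS mulrA factS natrM.
  rewrite invfM [n.+1%:R * _]mulrC -!mulrA [_^-1 * _]mulrCA.
  by rewrite mulVf ?pnatr_eq0// mulr1.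
rewrite /exp_re -D.
(* Any radius beyond [|t|] will do, since these series converge everywhere. *)
apply: (@pseries_snd_diffs _ _ (`|t| + 1)); rewrite ?D; try exact: is_cvg_exp_term.
by rewrite [ltRHS]ger0_norm// addrC -subr_gt0 addrK.
Qed.

Lemma cexp_scaleE z t :
  cexp (t%:C%C * z) = (exp_re z 1 t +i* exp_re z (- 'i%C)%R t)%C.
Proof. by rewrite /cexp !exp_re_scale mulr1. Qed.

(** The real and imaginary parts of [(exp (t z))' = z exp (t z)]. *)
Lemma exp_re_derivatives z t :
  exp_re z (1 * z) t = complex.Re z * exp_re z 1 t - complex.Im z * exp_re z (- 'i%C) t
  /\ exp_re z (- 'i%C * z) t = complex.Re z * exp_re z (- 'i%C) t + complex.Im z * exp_re z 1 t.
Proof.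
rewrite -mulNr -!exp_re_linear; case: z => a b /=; split; congr exp_re;
 apply/eqP; rewrite eq_complex/=;
 by rewrite !(mul0r, mul1r, mulr0, mulr1, subr0, sub0r, add0r, addr0,
    mulrN1, mulN1r, opprK, oppr0, mulrN, mulNr) !eqxx.
Qed.

(** The derivative is bounded only to the right of [a], because [exp (t z)] with [Re z <= 0] is
    controlled only for [t >= 0]. *)
Lemma MVT_bound (f df : R -> R) (a b K : R) : a <= b ->
  (forall t, is_derive t (1 : R) f (df t)) ->
  (forall t, a <= t -> `|df t| <= K) -> `|f b - f a| <= K * (b - a).
Proof.
move=> ab fd dK.
have [|c] := @MVT_segment R f df a b ab (fun t _ => fd t).
  by apply: derivable_within_continuous => t _; exact: ex_derive.
rewrite in_itv/= => /andP[ac _] ->.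
by rewrite normrM (ger0_norm (_ : 0 <= b - a)) ?subr_ge0// ler_wpM2r ?subr_ge0// dK.
Qed.

(* [|exp (t z)|^2 = f^2 + g^2] has derivative [2 Re z (f^2 + g^2) <= 0]. *)
Lemma exp_re_bound z t : complex.Re z <= 0 -> 0 <= t ->
  exp_re z 1 t ^+ 2 + exp_re z (- 'i%C) t ^+ 2 <= 1.
Proof.
move=> z0 t0.
set h := fun s => exp_re z 1 s ^+ 2 + exp_re z (- 'i%C) s ^+ 2.
have dh s : is_derive s (1 : R) h (2 * complex.Re z * h s).
  have d1 := is_derive_exp_re z 1 s; have d2 := is_derive_exp_re z (- 'i%C) s.
  have [e1 e2] := exp_re_derivatives z s.
  rewrite e1 in d1; rewrite e2 in d2.
  apply: is_derive_eq.
  by rewrite /h /GRing.scale/=; ring.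
have h1 : h 0 = 1 by rewrite /h !exp_re0/= oppr0 expr1n expr0n addr0.
have [|c _] := @MVT_segment R h (fun s => 2 * complex.Re z * h s) 0 t t0
  (fun s _ => dh s).
  by apply: derivable_within_continuous => s _; exact: ex_derive.
rewrite subr0 h1 -[leLHS]/(h t) -subr_le0 => ->.
have h0 : 0 <= h c by rewrite addr_ge0// sqr_ge0.
rewrite mulr_le0_ge0// mulr_le0_ge0//.
by rewrite mulr_ge0_le0.
Qed.

Lemma sqrD_le1 (a b : R) : a ^+ 2 + b ^+ 2 <= 1 -> `|a| <= 1.
Proof.
move=> H; rewrite -[leRHS](@expr1n R 2) -real_normK ?num_real// in H *.
rewrite -(@ler_pXn2r R 2)// ?nnegrE// expr1n; move: H; have := sqr_ge0 b; lra.
Qed.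

(** For [t >= 0] both parts of [exp (t z)] have modulus at most 1, so their derivatives are at most
    [|Re z| + |Im z|]. Composition with the 1-Lipschitz map [t |-> |t|] extends this to the line. *)
Lemma blip_cexp_abs z : complex.Re z <= 0 ->
  blip (fun x y : R => `|x - y|) (fun t => cexp (`|t|%:C%C * z)).
Proof.
move=> z0.
set L := `|complex.Re z| + `|complex.Im z|.
have fb t : 0 <= t -> `|exp_re z 1 t| <= 1.
  by move=> t0; apply: sqrD_le1 (exp_re_bound z0 t0).
have gb t : 0 <= t -> `|exp_re z (- 'i%C) t| <= 1.
  by move=> t0; apply: (@sqrD_le1 _ (exp_re z 1 t)); rewrite addrC exp_re_bound.
have ab (c e p q : R) : `|p| <= 1 -> `|q| <= 1 -> `|c * p + e * q| <= `|c| + `|e|.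
  move=> p1 q1; apply: le_trans (ler_normD _ _) _; rewrite !normrM.
  by apply: lerD; rewrite -[leRHS]mulr1 ler_wpM2l.
have lip (w : C) : (forall t, 0 <= t -> `|exp_re z (w * z) t| <= L) ->
    forall x y, `|exp_re z w `|x| - exp_re z w `|y| | <= L * `|x - y|.
  move=> wb x y; wlog xy : x y / `|x| <= `|y|.
    by move=> H; case: (leP `|x| `|y|) => [|/ltW] /H//; rewrite distrC (distrC y).
  rewrite distrC; apply: le_trans (MVT_bound (K := L) xy (is_derive_exp_re z w) _) _.
    by move=> t xt; apply: wb; apply: le_trans xt.
  by rewrite ler_wpM2l ?addr_ge0// distrC; apply: le_trans (ler_norm _) (ler_dist_dist _ _).
apply: blip_ReIm.
- apply: (@blip_realP _ _ _ _ 1 L) => [x|x y]; rewrite ?cexp_scaleE/=; first exact: fb.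
  apply: lip => t t0; rewrite (exp_re_derivatives z t).1 -mulNr.
  by rewrite /L -(normrN (complex.Im z)); apply: ab; [exact: fb|exact: gb].
- apply: (@blip_realP _ _ _ _ 1 L) => [x|x y]; rewrite ?cexp_scaleE/=; first exact: gb.
  apply: lip => t t0; rewrite (exp_re_derivatives z t).2.
  by rewrite /L; apply: ab; [exact: gb|exact: fb].
Qed.

End ComplexExponential.

(** * Functional calculus and stable projection of a diagonalizable matrix *)

Section SpectralResolution.
Variables (R : realType) (n : nat) (I : finType).
Local Notation C := (R[i]).
Variables (mu : I -> C) (E : I -> 'M[C]_n.+1).

(** A complete family of orthogonal idempotents: products and powers of the matrices
    [\sum_k a k *: E k] are computed on the coefficients. *)
Definition spectral_resolution :=
  (forall k l, E k *m E l = if k == l then E k else 0) /\ \sum_k E k = 1.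

Hypothesis HE : spectral_resolution.

Lemma resolution_mul (a b : I -> C) :
  (\sum_k a k *: E k) *m (\sum_k b k *: E k) = \sum_k (a k * b k) *: E k.
Proof.
rewrite mulmx_suml; apply: eq_bigr => k _.
rewrite mulmx_sumr (bigD1 k)//= big1 => [|l lk].
  by rewrite addr0 -scalemxAl -scalemxAr HE.1 eqxx scalerA.
by rewrite -scalemxAl -scalemxAr HE.1 eq_sym (negbTE lk) !scaler0.
Qed.

Lemma resolution_exp (a : I -> C) m :
  (\sum_k a k *: E k) ^+ m = \sum_k (a k ^+ m) *: E k.
Proof.
elim: m => [|m IH].
  by rewrite expr0 -HE.2; apply: eq_bigr => k _; rewrite scale1r.
by rewrite exprS IH -mulmxE resolution_mul; apply: eq_bigr => k _; rewrite exprS.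
Qed.

Lemma resolution_apply (a : I -> C) k (w : 'cV[C]_n.+1) :
  E k *m ((\sum_l a l *: E l) *m w) = a k *: (E k *m w).
Proof.
rewrite mulmxA mulmx_sumr (bigD1 k)//= big1 => [|l lk].
  by rewrite addr0 -scalemxAr HE.1 eqxx scalemxAl.
by rewrite -scalemxAr HE.1 eq_sym (negbTE lk) scaler0.
Qed.

Let A := \sum_k mu k *: E k.

(** Applying [E k] to [(A - m)^(n+1) w = 0] gives [(mu k - m)^(n+1) E k w = 0], and [m] differs from
    [mu k] because only [m] satisfies [P]. *)
Lemma gen_eigvec_resolution (P : C -> Prop) (w : 'cV[C]_n.+1) k :
  gen_eigvec_in A P w -> ~ P (mu k) -> E k *m w = 0.
Proof.
move=> [m [Pm mw]] nP.
have Am : A - m%:M = \sum_l (mu l - m) *: E l.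
  rewrite -scalemx1 -[1%:M]HE.2 scaler_sumr -sumrB.
  by apply: eq_bigr => l _; rewrite scalerBl.
move: mw; rewrite Am resolution_exp => /(congr1 (mulmx (E k))).
rewrite resolution_apply mulmx0 => /eqP; rewrite scaler_eq0 expf_eq0/= subr_eq0.
by case/orP=> [/eqP mum|/eqP//]; case: nP; rewrite mum.
Qed.

(** From left to right, [v] is the sum of its components [E k *m v]. Conversely, every summand of an
    element of the generalized eigenspace is annihilated by each [E k] with [~~ p k], hence fixed by
    the sum of the others. *)
Lemma gen_eigspace_resolution (P : C -> Prop) (p : pred I) (m0 : C) v :
  (#|I| <= n.+1)%N -> P m0 -> (forall k, reflect (P (mu k)) (p k)) ->
  (\sum_(k | p k) E k) *m v = v <-> gen_eigspace A P v.
Proof.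
move=> cI Pm0 pP; split=> [Qv|].
(* [gen_eigspace] asks for exactly [n.+1] summands: [E k *m v] goes to the slot numbered
   [enum_rank k], and the slots left over are empty sums. *)
- pose w (j : 'I_n.+1) : 'cV[C]_n.+1 :=
    \sum_(k | p k && (enum_rank k == j :> nat)) E k *m v.
  exists w; split.
    rewrite /w (exchange_big_dep p)/=; last by move=> ? ? _ /andP[].
    rewrite -[LHS]Qv mulmx_suml; apply: eq_bigr => k pk.
    have kn : (enum_rank k < n.+1)%N by apply: leq_trans cI.
    rewrite (big_pred1 (Ordinal kn))// => j /=.
    by rewrite pk/= eq_sym -val_eqE.
  move=> j; case: (pickP [pred k | p k && (enum_rank k == j :> nat)]) => /=.
    move=> k /andP[pk /eqP kj]; exists (mu k); split; first exact/pP.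
    have -> : w j = E k *m v.
      rewrite /w (big_pred1 k)// => l /=; rewrite -kj.
      have [->|lk] := eqVneq l k; first by rewrite pk eqxx.
      by rewrite val_eqE (inj_eq enum_rank_inj) (negbTE lk) andbF.
    have Am : A - (mu k)%:M = \sum_l (mu l - mu k) *: E l.
      rewrite -scalemx1 -[1%:M]HE.2 scaler_sumr -sumrB.
      by apply: eq_bigr => l _; rewrite scalerBl.
    rewrite Am resolution_exp mulmxA mulmx_suml big1 ?mul0mx// => l _.
    rewrite -scalemxAl HE.1; have [->|_] := eqVneq l k; last by rewrite scaler0.
    by rewrite subrr expr0n scale0r.
  (* An empty slot holds the zero vector, for which [m0] serves as eigenvalue. *)
  move=> H; exists m0; split=> //.
  by rewrite /w big_pred0// mulmx0.
- move=> [w [-> Hw]]; rewrite mulmx_sumr; apply: eq_bigr => j _.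
  have Z : (\sum_(k | ~~ p k) E k) *m w j = 0.
    rewrite mulmx_suml big1// => k npk.
    by apply: gen_eigvec_resolution (Hw j) _; apply/pP.
  rewrite -[RHS]mul1mx -[1%:M]HE.2 [in RHS](bigID p)/= [RHS]mulmxDl.
  by rewrite Z addr0.
Qed.

(** [stable_proj] is a chosen matrix, but an idempotent is determined by its range and its kernel,
    so it suffices that the explicit sum [Q] has the required ones. *)
Lemma stable_projE : (#|I| <= n.+1)%N ->
  stable_proj A = \sum_(k | complex.Re (mu k) < 0) E k.
Proof.
move=> cI; set Q := \sum_(k | _) _.
have QE : Q = \sum_k (complex.Re (mu k) < 0)%R%:R *: E k.
  rewrite /Q big_mkcond; apply: eq_bigr => k _.
  by case: ifP => _; rewrite ?scale1r ?scale0r.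
have QC : \sum_(k | ~~ (complex.Re (mu k) < 0)) E k = 1 - Q.
  by rewrite -HE.2 [in RHS](bigID (fun k => complex.Re (mu k) < 0))/= [X in _ = X - _]addrC addrK.
have HQ : is_stable_proj A Q.
  split; last split=> v.
  - rewrite QE resolution_mul; apply: eq_bigr => k _.
    by case: (_ < 0); rewrite ?mulr1 ?mulr0.
  (* Here [-1], and [0] in the next case, are sample points of the two half-planes. *)
  - apply: (@gen_eigspace_resolution _ _ (-1)) => //.
      by rewrite /= ltrN10.
    by move=> k; apply: idP.
  - rewrite -(@gen_eigspace_resolution _ (fun k => ~~ (complex.Re (mu k) < 0)) 0)//=.
    + rewrite QC mulmxBl mul1mx; split=> [->|/eqP]; first by rewrite subr0.
      by rewrite subr_eq addrC -subr_eq subrr eq_sym => /eqP.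
    + by rewrite ltxx.
    + by move=> k; apply: negP.
rewrite /stable_proj; case: xgetP => [Q' _ [Q'Q' [ran ker]]|/(_ Q)//].
have [_ [ranQ kerQ]] := HQ.
have colM (X Y : 'M[C]_n.+1) j : col j (X *m Y) = X *m col j Y.
  by rewrite !colE mulmxA.
(* The columns of [Q'] lie in the common range; below, those of [1 - Q'] lie in the common kernel,
   so [Q = Q *m Q' = Q']. *)
have QQ' : Q *m Q' = Q'.
  apply/matrixP => i j; have /matrixP/(_ i 0) : Q *m (col j Q') = col j Q'.
    by apply/ranQ/ran; rewrite -colM Q'Q'.
  by rewrite -colM ![col _ _ _ _]mxE.
have : Q *m (1 - Q') = 0.
  apply/matrixP => i j; have /matrixP/(_ i 0) : Q *m (col j (1 - Q')) = 0.
    by apply/kerQ/ker; rewrite -colM mulmxBr mulmx1 Q'Q' subrr;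
      apply/matrixP=> ? ?; rewrite !mxE.
  by rewrite -colM [col _ _ _ _]mxE => ->; rewrite !mxE.
by rewrite mulmxBr mulmx1 QQ' => /eqP; rewrite subr_eq0 => /eqP.
Qed.

End SpectralResolution.

(** * Real 2x2 matrices, their positive square roots and polar factors *)

Section TwoByTwo.

Lemma mx2P (K : Type) (A B : 'M[K]_2) :
  A 0 0 = B 0 0 -> A 0 1 = B 0 1 -> A 1 0 = B 1 0 -> A 1 1 = B 1 1 -> A = B.
Proof.
have I2 (i : 'I_2) : i = 0 \/ i = 1.
  by case: i => [[|[|//]] ?]; [left|right]; exact: val_inj.
by move=> *; apply/matrixP => i j; case: (I2 i) => ->; case: (I2 j) => ->.
Qed.

Lemma mulmx2E (K : pzSemiRingType) m n (A : 'M[K]_(m, 2)) (B : 'M[K]_(2, n)) i j :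
  (A *m B) i j = A i 0 * B 0 j + A i 1 * B 1 j.
Proof.
rewrite mxE !big_ord_recl big_ord0 addr0.
by rewrite (_ : lift ord0 ord0 = 1)//; exact: val_inj.
Qed.

Variable R : realType.
Local Notation C := (R[i]).
Implicit Types (p q : C) (S : 'M[R]_2).

(* the real matrix of the map [z |-> p z + q z^*] on C = R^2 *)
Definition rlin p q : 'M[R]_2 := \matrix_(i < 2, j < 2)
  if i == 0 then if j == 0 then complex.Re p + complex.Re q
                 else complex.Im q - complex.Im p
  else if j == 0 then complex.Im p + complex.Im q
       else complex.Re p - complex.Re q.

Lemma rlinM p q p' q' :
  rlin p q *m rlin p' q' = rlin (p * p' + q * q'^*%C) (p * q' + q * p'^*%C).
Proof.
case: p q p' q' => [a b] [c d] [a' b'] [c' d'].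
by apply: mx2P; rewrite mulmx2E !mxE/=; ring.
Qed.

Lemma tr_rlin p q : (rlin p q)^T = rlin p^*%C q.
Proof.
by case: p q => [a b] [c d]; apply: mx2P; rewrite !mxE/=; ring.
Qed.

Lemma det_mx2 S : \det S = S 0 0 * S 1 1 - S 0 1 * S 1 0.
Proof.
rewrite (expand_det_row _ 0) !big_ord_recl big_ord0 addr0 /cofactor !det_mx11 !mxE/=.
have l01 : lift ord0 ord0 = 1 :> 'I_2 by exact: val_inj.
have l10 : lift 1 0 = 0 :> 'I_2 by exact: val_inj.
by rewrite !l01 !l10 expr0 expr1; ring.
Qed.

(** The quadratic form at [(S 0 1, - S 0 0)] equals [S 0 0] times the determinant. If [S 0 0 = 0],
    the vector [(S 1 1, - S 0 1)] is used, and if both diagonal entries vanish, [(1, 1)] and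
    [(1, -1)]. *)
Lemma psd_entries S : psd S ->
  [/\ S 1 0 = S 0 1, 0 <= S 0 0, 0 <= S 1 1 & 0 <= S 0 0 * S 1 1 - S 0 1 ^+ 2].
Proof.
move=> [sym pos].
have s : S 1 0 = S 0 1 by rewrite -{1}sym mxE.
have P (a b : R) : 0 <= a ^+ 2 * S 0 0 + 2 * a * b * S 0 1 + b ^+ 2 * S 1 1.
  have := pos (\col_(i < 2) if i == 0 then a else b).
  by rewrite !mulmx2E !mxE/= s; lra.
have P10 := P 1 0; have P01 := P 0 1.
have S0 : 0 <= S 0 0 by lra.
have S1 : 0 <= S 1 1 by lra.
split=> //; move: S0 S1; rewrite le_eqVlt => /predU1P[S00|S0].
  rewrite le_eqVlt => /predU1P[S11|S1]; last first.
    rewrite -(pmulr_rge0 _ S1); have := P (S 1 1) (- S 0 1).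
    by rewrite -S00; congr (0 <= _); ring.
  have P11 := P 1 1; have P1m := P 1 (-1); rewrite -S00 -S11 in P11 P1m.
  by have -> : S 0 1 = 0; [lra|rewrite -S00 mul0r expr0n subrr].
move=> _; rewrite -(pmulr_rge0 _ S0); have := P (S 0 1) (- S 0 0).
by congr (0 <= _); ring.
Qed.

(** By Cayley-Hamilton, [S^2 = tr S * S - det S]. The square determines [det S >= 0], then
    [tr S >= 0] through [(tr S)^2 = tr (S^2) + 2 det S], and then [S], the trace being nonzero. *)
Lemma psd_sqrt_uniq S T : psd S -> psd T -> S *m S = T *m T -> 0 < \det T -> S = T.
Proof.
move=> /psd_entries[s10 s0 s1 ds] /psd_entries[t10 t0 t1 dt] ST.
rewrite det_mx2 t10 => dT.
have E i j : S i 0 * S 0 j + S i 1 * S 1 j = T i 0 * T 0 j + T i 1 * T 1 j.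
  by rewrite -!mulmx2E ST.
have E00 := E 0 0; have E01 := E 0 1; have E11 := E 1 1.
rewrite s10 t10 in E00 E01 E11.
set a := S 0 0 in s0 s1 ds E00 E01 E11 *; set b := S 0 1 in ds E00 E01 E11 s10 *.
set c := S 1 1 in s1 ds E00 E01 E11 *; set a' := T 0 0 in t0 dt dT E00 E01 *.
set b' := T 0 1 in dt dT E00 E01 E11 t10 *; set c' := T 1 1 in t1 dt dT E01 E11 *.
have det2 : (a * c - b ^+ 2) ^+ 2 = (a' * c' - b' ^+ 2) ^+ 2.
  have -> : (a * c - b ^+ 2) ^+ 2 =
    (a * a + b * b) * (b * b + c * c) - (a * b + b * c) ^+ 2 by ring.
  by rewrite E00 E01 E11; ring.
have det1 : a * c - b ^+ 2 = a' * c' - b' ^+ 2.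
  by apply/eqP; rewrite -(@eqrXn2 _ 2) ?det2.
have tr1 : a + c = a' + c'.
  apply/eqP; rewrite -(@eqrXn2 _ 2) ?addr_ge0//; apply/eqP.
  transitivity ((a * a + b * b) + (b * b + c * c) + 2 * (a * c - b ^+ 2)); first by ring.
  by rewrite E00 E11 det1; ring.
have tr0 : a' + c' != 0.
  apply: contraTN dT => /eqP tr0; rewrite -leNgt.
  have -> : a' = 0 by lra.
  by rewrite mul0r sub0r oppr_le0 -expr2 sqr_ge0.
have canc x y : (a' + c') * x = (a' + c') * y -> x = y by move/(mulfI tr0).
apply: mx2P; rewrite ?s10 ?t10 -/a -/b -/c -/a' -/b' -/c'.
- by apply: canc; rewrite -{1}tr1; lra.
- by apply: canc; rewrite -{1}tr1; lra.
- by apply: canc; rewrite -{1}tr1; lra.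
- by apply: canc; rewrite -{1}tr1; lra.
Qed.

Lemma det_rlin p q : \det (rlin p q) = complex.Re (p * p^*%C - q * q^*%C).
Proof. by case: p q => [a b] [c d]; rewrite det_mx2 !mxE/=; ring. Qed.

Lemma psd_rlin (s : R) q : 0 < s -> 0 < \det (rlin s%:C%C q) -> psd (rlin s%:C%C q).
Proof.
case: q => c d s0; rewrite det_rlin/= => H.
split; first by rewrite tr_rlin /= oppr0.
move=> v; rewrite !mulmx2E !mxE/=.
set x := v 0 0; set y := v 1 0.
(* Multiplying the form by [s + c], positive since [s^2 > c^2 + d^2], completes the square. *)
have sc : 0 < s + c by nra.
rewrite -(pmulr_rge0 _ sc).
set E := (X in 0 <= X).
have -> : E = ((s + c) * x + d * y) ^+ 2 + (s ^+ 2 - c ^+ 2 - d ^+ 2) * y ^+ 2.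
  by rewrite /E; ring.
rewrite addr_ge0 ?sqr_ge0// mulr_ge0 ?sqr_ge0//; lra.
Qed.

Lemma psd_sqrt_rlin (s : R) q : 0 < s -> 0 < \det (rlin s%:C%C q) ->
  psd_sqrt (rlin s%:C%C q *m rlin s%:C%C q) = rlin s%:C%C q.
Proof.
move=> s0 d0; have psdT := psd_rlin s0 d0; rewrite /psd_sqrt.
case: xgetP => [S _ [psdS SS]|/(_ (rlin s%:C%C q))]; first exact: psd_sqrt_uniq.
by case.
Qed.

(* With [A = w^2 al] and [B = w^2 b e] one has [det M = w^4 h^2] and the trace
   of [|M|^(1/2)] is [w f]. *)
Lemma polar_rlin (w g h f : R) (al b e : C) :
  0 < w -> 0 < g -> 0 < h -> 0 < f ->
  al * al^*%C = (g ^+ 2)%:C%C -> b * b^*%C = (g ^+ 2 - h ^+ 2)%:C%C ->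
  e * e^*%C = 1 -> f ^+ 2 = 2 * (g + h) ->
  let M := rlin ((w ^+ 2)%:C%C * al) ((w ^+ 2)%:C%C * (b * e)) in
  let S := rlin (w * f / 2)%:C%C (al^*%C * b / (g * f)%:C%C * (w%:C%C * e)) in
  psd_sqrt (mabs M) = S /\
  M *m invmx S = rlin ((w * f / (2 * g))%:C%C * al) (b / f%:C%C * (w%:C%C * e)).
Proof.
move=> w0 g0 h0 f0 hal hb he hf M S.
have cg : g%:C%C != 0 :> C by rewrite fmorph_eq0 gt_eqF.
have cf : f%:C%C != 0 :> C by rewrite fmorph_eq0 gt_eqF.
have hfC : f%:C%C ^+ 2 = 2%:R * (g%:C%C + h%:C%C) :> C.
  by rewrite -rmorphXn hf rmorphM rmorph_nat rmorphD.
have {}hal : al * al^*%C = g%:C%C ^+ 2 by rewrite hal rmorphXn.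
have {}hb : b * b^*%C = g%:C%C ^+ 2 - h%:C%C ^+ 2 by rewrite hb rmorphB !rmorphXn.
(* Eliminating [h] turns the remaining identities into rational ones in [f] and [g]. *)
have hC : h%:C%C = f%:C%C ^+ 2 / 2%:R - g%:C%C :> C by rewrite hfC; field.
have realE : (forall r : R, (r%:C%C)^*%C = r%:C%C :> C) by exact: conjc_real.
have JM (x y : C) : (x * y)^*%C = x^*%C * y^*%C by exact: rmorphM.
have JV (x : C) : (x^-1)^*%C = (x^*%C)^-1 by exact: conjc_inv.
have RM (x y : R) : (x * y)%:C%C = x%:C%C * y%:C%C :> C by exact: rmorphM.
have RX (x : R) n : (x ^+ n)%:C%C = x%:C%C ^+ n :> C by exact: rmorphXn.
have RV (x : R) : (x^-1)%:C%C = x%:C%C^-1 :> C by exact: fmorphV.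
have R2 : 2%:C%C = 2%:R :> C by exact: rmorph_nat.
pose sS := (w * f / 2)%:C%C : C.
pose q := al^*%C * b / (g * f)%:C%C * (w%:C%C * e).
have SE : S = rlin sS q by [].
have sJ : sS^*%C = sS by exact: realE.
have sE : sS = w%:C%C * f%:C%C / 2%:R.
  by rewrite /sS !RM RV R2.
have qE : q = al^*%C * b / (g%:C%C * f%:C%C) * (w%:C%C * e) by rewrite /q RM.
have qJ : q^*%C = al * b^*%C / (g%:C%C * f%:C%C) * (w%:C%C * e^*%C).
  by rewrite qE !JM JV JM !realE conjcK.
have qq : q * q^*%C = w%:C%C ^+ 2 * (g%:C%C ^+ 2 - h%:C%C ^+ 2) / f%:C%C ^+ 2.
  rewrite qJ qE; transitivity ((al * al^*%C) * (b * b^*%C) * (e * e^*%C) * w%:C%C ^+ 2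
     / (g%:C%C * f%:C%C) ^+ 2); first by field; rewrite ?cf ?cg.
  by rewrite hal hb he; field; rewrite ?cf ?cg.
(* [P] is [|M|]: it is the square of [S], and its own square is [M^T *m M]. Uniqueness of the
   positive root is then applied twice. *)
set P := rlin (w ^+ 2 * g)%:C%C ((w ^+ 2)%:C%C * (al^*%C * b * e) / g%:C%C).
have SS : S *m S = P.
  rewrite SE /P rlinM sJ qq sE; congr rlin.
    by rewrite RM RX hC; field.
  by rewrite qE RX; field; rewrite ?cf ?cg.
have PP : P *m P = M^T *m M.
  rewrite /P /M tr_rlin !rlinM realE; congr rlin.
    rewrite !RM !JM JV !realE conjcK.
    transitivity (w%:C%C ^+ 4 * g%:C%C ^+ 2
      + w%:C%C ^+ 4 * ((al * al^*%C) * (b * b^*%C) * (e * e^*%C)) / g%:C%C ^+ 2).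
      by field.
    transitivity (w%:C%C ^+ 4 * (al * al^*%C)
      + w%:C%C ^+ 4 * ((b * b^*%C) * (e * e^*%C))); last by ring.
    by rewrite hal hb he; field.
  by rewrite !RM !JM !realE; field.
have dS : \det S = w ^+ 2 * h.
  rewrite SE det_rlin sJ qq sE.
  rewrite [X in complex.Re X](_ : _ = (w ^+ 2 * h)%:C%C)//.
  by rewrite RM RX hC; field.
have dP : \det P = w ^+ 4 * h ^+ 2.
  by rewrite -SS det_mulmx dS; ring.
split.
  rewrite /mabs -PP psd_sqrt_rlin -/P ?dP ?mulr_gt0 ?exprn_gt0//.
  by rewrite -SS psd_sqrt_rlin -/S ?dS ?divr_gt0 ?mulr_gt0 ?exprn_gt0.
have uS : S \in unitmx by rewrite unitmxE dS unitfE mulf_neq0// ?expf_neq0// gt_eqF.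
set V := rlin _ _.
suff <- : V *m S = M by rewrite mulmxK.
rewrite /V SE rlinM sJ qJ qE sE /M !RM RV !RM R2.
congr rlin.
  transitivity (w%:C%C ^+ 2 * al * (f%:C%C ^+ 2 / 4%:R / g%:C%C
     + (b * b^*%C) * (e * e^*%C) / (g%:C%C * f%:C%C ^+ 2))).
    by field; rewrite ?cf ?cg.
  by rewrite hb he hC; field; rewrite ?cf ?cg.
transitivity (w%:C%C ^+ 2 * b * e * ((al * al^*%C) / (2%:R * g%:C%C ^+ 2) + 2%:R^-1)).
  by field; rewrite ?cf ?cg.
by rewrite hal; field.
Qed.

End TwoByTwo.

(** * Lipschitz continuity of the polar factors *)

Section BoundedLipschitzPolar.
Variables (R : realType) (T : Type) (d : T -> T -> R).
Local Notation C := (R[i]).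

Lemma blip_Re (f : T -> C) : blip d f -> blip d (fun x => (complex.Re (f x))%:C%C).
Proof.
move=> [K [L [fK fL]]]; apply: (@blip_realP _ _ _ _ K L) => [x|x y].
  exact: le_trans (normc_ge_re _) (fK x).
apply: le_trans (fL x y); apply: le_trans _ (normc_ge_re _).
by case: (f x) => ? ?; case: (f y).
Qed.

Lemma blip_Im (f : T -> C) : blip d f -> blip d (fun x => (complex.Im (f x))%:C%C).
Proof.
move=> bf; apply: eq_blip (blip_Re (blipM (blip_cst d (- 'i%C)) bf)) => x /=.
by case: (f x) => a b /=; congr _%:C%C; ring.
Qed.

Lemma blip_conj (f : T -> C) : blip d f -> blip d (fun x => (f x)^*%C).
Proof.
have nJ (z : C) : normc z^*%C = normc z by case: z => a b /=; rewrite sqrrN.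
move=> [K [L [fK fL]]]; exists K, L; split=> [x|x y]; first by rewrite nJ.
by rewrite -rmorphB/= nJ.
Qed.

Lemma ler_dist_normc (y z : C) : `|normc y - normc z| <= normc (y - z).
Proof.
have H (a b : C) : normc a - normc b <= normc (a - b).
  by rewrite lerBlDr; apply: le_trans (le_normcD _ _); rewrite subrK.
rewrite ler_norml H andbT lerNl opprB.
by rewrite -[y - z]opprB normcN H.

Qed.

Lemma blip_normc (f : T -> C) : blip d f -> blip d (fun x => (normc (f x))%:C%C).
Proof.
move=> [K [L [fK fL]]]; apply: (@blip_realP _ _ _ _ K L) => [x|x y].
  by rewrite ger0_norm ?normc_ge0.
exact: le_trans (ler_dist_normc _ _) (fL x y).
Qed.

(** The map [z |-> z^2 / |z|] is homogeneous of degree one. Its increments are written with the unit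
    factors [a / |a|] and [b / |b|] only, so the constant 3 holds even where [f] comes close to
    0. *)
Lemma blip_sqr_div_normc (f : T -> C) : (forall x, f x != 0) -> blip d f ->
  blip d (fun x => f x ^+ 2 / (normc (f x))%:C%C).
Proof.
move=> f0 [K [L [fK fL]]]; exists K, (3 * L).
have n0 x : normc (f x) != 0 by apply: contra (f0 x) => /eqP/eq0_normc ->.
have n0C x : (normc (f x))%:C%C != 0 :> C by rewrite fmorph_eq0.
split=> [x|x y].
  by rewrite normcM normcV normcX normcR ger0_norm ?normc_ge0// expr2 mulfK.
set a := f x; set b := f y.
have -> : a ^+ 2 / (normc a)%:C%C - b ^+ 2 / (normc b)%:C%C =
    a / (normc a)%:C%C * ((a - b) + b / (normc b)%:C%C * ((normc b)%:C%C - (normc a)%:C%C))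
    + (a - b) * (b / (normc b)%:C%C).
  by field; rewrite /a /b !n0C.
have u1 x' : normc (f x' / (normc (f x'))%:C%C) = 1.
  by rewrite normcM normcV normcR ger0_norm ?normc_ge0// divff.
apply: le_trans (le_normcD _ _) _.
rewrite (normcM (a / _)) (normcM (a - b)) !u1 mul1r mulr1.
apply: le_trans (_ : 3 * normc (a - b) <= _); last by rewrite -mulrA ler_wpM2l// fL.
have := le_normcD (a - b) (b / (normc b)%:C%C * ((normc b)%:C%C - (normc a)%:C%C)).
rewrite (normcM (b / (normc b)%:C%C)) u1 mul1r -rmorphB normcR => H.
have := ler_dist_normc b a; rewrite -(normcN (b - a)) opprB; lra.
Qed.

Lemma mxblip_rlin (P Q : T -> C) : blip d P -> blip d Q ->
  mxblip d (fun x => cmx (rlin (P x) (Q x))).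
Proof.
move=> bP bQ i j; have N f : blip d f -> blip d (fun x => - f x).
  by move=> bf; apply: eq_blip (blipM (blip_cst d (-1)) bf) => x; rewrite mulN1r.
have [rP iP rQ iQ] := And4 (blip_Re bP) (blip_Im bP) (blip_Re bQ) (blip_Im bQ).
case: (eqVneq i 0) => i0; case: (eqVneq j 0) => j0.
- by apply: eq_blip (blipD rP rQ) => x; rewrite !mxE i0 j0/= rmorphD.
- by apply: eq_blip (blipD iQ (N _ iP)) => x; rewrite !mxE i0/= (negbTE j0) rmorphB.
- by apply: eq_blip (blipD iP iQ) => x; rewrite !mxE j0/= (negbTE i0) rmorphD.
- by apply: eq_blip (blipD rP (N _ rQ)) => x; rewrite !mxE (negbTE i0) (negbTE j0) rmorphB.
Qed.

(** The weight [w] may tend to 0, and the phase [e] enters only through [w e], because it can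
    oscillate quickly where [w] is small. All divisions are by quantities that [c] keeps away from
    0. *)
Lemma mxblip_polar (w : T -> R) (al b e : T -> C) (M : T -> 'M[R]_2) (c : R) :
  0 < c -> (forall x, 0 < w x) -> (forall x, e x * (e x)^*%C = 1) ->
  (forall x, c <= normc (al x) ^+ 2 - normc (b x) ^+ 2) ->
  blip d (fun x => (w x)%:C%C) -> blip d (fun x => (w x)%:C%C * e x) ->
  blip d al -> blip d b ->
  (forall x, M x = rlin ((w x ^+ 2)%:C%C * al x) ((w x ^+ 2)%:C%C * (b x * e x))) ->
  mxblip d (fun x => cmx (psd_sqrt (mabs (M x)))) /\
  mxblip d (fun x => cmx (M x *m invmx (psd_sqrt (mabs (M x))))).
Proof.
move=> c0 w0 he hc bw bwe bal bb MD.
(* The pointwise data of [polar_rlin]; both [g] and [h] are at least [sqrt c]. *)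
pose g x := normc (al x); pose h x := Num.sqrt (g x ^+ 2 - normc (b x) ^+ 2).
pose f x := Num.sqrt (2 * (g x + h x)).
have sc : 0 < Num.sqrt c by rewrite sqrtr_gt0.
have nz (z : C) : z * z^*%C = (normc z ^+ 2)%:C%C.
  case: z => p q /=; rewrite sqr_sqrtr ?addr_ge0 ?sqr_ge0//.
  by apply/eqP; rewrite eq_complex/=; apply/andP; split; apply/eqP; ring.
have hsc x : Num.sqrt c <= h x by apply: ler_wsqrtr; exact: hc.
have h2 x : h x ^+ 2 = g x ^+ 2 - normc (b x) ^+ 2.
  by rewrite sqr_sqrtr// (le_trans _ (hc x))// ltW.
have gsc x : Num.sqrt c <= g x.
  apply: le_trans (hsc x) _; rewrite -(@ler_pXn2r _ 2) ?nnegrE ?sqrtr_ge0 ?normc_ge0//.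
  by rewrite h2 gerBl sqr_ge0.
have g0 x : 0 < g x := lt_le_trans sc (gsc x).
have h0 x : 0 < h x := lt_le_trans sc (hsc x).
have fc x : 2 * (Num.sqrt c + Num.sqrt c) <= 2 * (g x + h x).
  by rewrite ler_wpM2l// lerD.
have c1 : 0 < 2 * (Num.sqrt c + Num.sqrt c) by rewrite mulr_gt0// addr_gt0.
have f0 x : 0 < f x by rewrite sqrtr_gt0 (lt_le_trans c1).
have f2 x : f x ^+ 2 = 2 * (g x + h x).
  by rewrite sqr_sqrtr// (le_trans (ltW c1)).
have bg : blip d (fun x => (g x)%:C%C) by exact: blip_normc.
have bh : blip d (fun x => (h x)%:C%C).
  apply: (blip_sqrt c0 hc).
  apply: eq_blip (blipD (blipM bg bg)
    (blipM (blip_cst d (-1)) (blipM (blip_normc bb) (blip_normc bb)))) => x.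
  by rewrite rmorphB !rmorphXn/=; ring.
have bf : blip d (fun x => (f x)%:C%C).
  apply: (blip_sqrt c1 fc).
  apply: eq_blip (blipM (blip_cst d 2%:R) (blipD bg bh)) => x.
  by rewrite rmorphM rmorph_nat rmorphD.
have bVf : blip d (fun x => ((f x)%:C%C)^-1).
  apply: (@blipV _ _ _ _ (Num.sqrt (2 * (Num.sqrt c + Num.sqrt c)))) bf.
    by rewrite sqrtr_gt0.
  by move=> x; rewrite normcR gtr0_norm// ler_wsqrtr.
have bVg : blip d (fun x => ((g x)%:C%C)^-1).
  by apply: blipV sc _ bg => x; rewrite normcR gtr0_norm.
have hb x : b x * (b x)^*%C = (g x ^+ 2 - h x ^+ 2)%:C%C.
  by rewrite nz h2 subKr.
have PE x := polar_rlin (w0 x) (g0 x) (h0 x) (f0 x) (nz _) (hb x) (he x) (f2 x).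
rewrite /= in PE.
have Vr (r : R) : (r^-1)%:C%C = r%:C%C^-1 :> C by exact: fmorphV.
have Mr (r s : R) : (r * s)%:C%C = r%:C%C * s%:C%C :> C by exact: rmorphM.
split=> i j.
  apply: eq_blip (mxblip_rlin (blipM (blipM bw bf) (blip_cst d 2%:C%C^-1))
    (blipM (blipM (blipM (blip_conj bal) bb) (blipM bVg bVf)) bwe) i j) => x.
  by rewrite MD (PE x).1 !Mr Vr invfM.
apply: eq_blip (mxblip_rlin (blipM (blipM (blipM (blipM bw bf) (blip_cst d 2%:C%C^-1)) bVg) bal)
  (blipM (blipM bb bVf) bwe) i j) => x.
by rewrite MD (PE x).1 (PE x).2 !Mr Vr Mr invfM !mulrA.
Qed.

End BoundedLipschitzPolar.

(** * The potential as a real-linear map of the complex plane *)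

Section PulsePotential.
Variable R : realType.
Local Notation C := (R[i]).
Variables (eps gamma mu nu : R) (u v : R -> R).
Let n1 : C := (eps +i* gamma)%C.
Let n2 : C := (mu +i* nu)%C.
Let Psi (x : R) : C := (u x +i* v x)%C.
Let r := psinorm2 u v.

Lemma Mm_rlin x : Mm eps gamma mu nu u v x =
  rlin ((r x)%:C%C * (2%:R * n1 + 3%:R * (r x)%:C%C * n2))
       ((n1 + 2%:R * (r x)%:C%C * n2) * Psi x ^+ 2).
Proof.
rewrite /Mm /r; set s := psinorm2 u v x.
have se : s = u x ^+ 2 + v x ^+ 2 by [].
have nat2 (k : nat) : k%:R = (k%:R)%:C%C :> C by rewrite rmorph_nat.
rewrite !nat2 expr2 /n1 /n2 /Psi.
apply: mx2P; rewrite [LHS]mxE mulmx2E !mxE !big_ord1 !mxE /=;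
  rewrite ?se; ring.
Qed.

Let p x := 3 * (eps ^+ 2 + gamma ^+ 2) + 8 * (eps * mu + gamma * nu) * r x
  + 5 * (mu ^+ 2 + nu ^+ 2) * r x ^+ 2.

(** The factor [p] is [|2 n1 + 3 r n2|^2 - |n1 + 2 r n2|^2]. *)
Lemma det_Mm x : \det (Mm eps gamma mu nu u v x) = r x ^+ 2 * p x.
Proof.
rewrite Mm_rlin det_rlin /p /r /psinorm2 /n1 /n2 /Psi.
have nat2 (k : nat) : k%:R = (k%:R)%:C%C :> C by rewrite rmorph_nat.
by rewrite !nat2 expr2 /=; ring.
Qed.

End PulsePotential.

(** * Lower bounds on the line and smallness at infinity *)

Section LowerBound.
Variable R : realType.

(** The intermediate value theorem makes [f] positive everywhere; its minimum on a compact interval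
    and the tail bound [m] then give [c]. *)
Lemma continuous_neq0_lower_bound (f : R -> R) (X m : R) :
  continuous f -> (forall x, f x != 0) -> 0 < m ->
  (forall x, X <= `|x| -> m <= f x) -> exists2 c, 0 < c & forall x, c <= f x.
Proof.
move=> cf f0 m0 fm; pose Y := `|X| + 1.
have XY : X <= Y by rewrite /Y (le_trans (ler_norm X))// lerDl.
have Y0 : 0 <= Y by rewrite addr_ge0.
have YY : - Y <= Y by rewrite ge0_cp.
have wc a b : {within `[a, b], continuous f} by apply: continuous_subspaceT.
have fpos x : 0 < f x.
  have [xY|xY] := leP X `|x|; first exact: lt_le_trans (fm x xY).
  have xlY : x <= Y by rewrite (le_trans (ler_norm x))// (le_trans (ltW xY)).
  rewrite lt_def f0/= leNgt; apply/negP => fx0.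
  have fY : 0 < f Y by apply: lt_le_trans (fm _ _) => //; rewrite ger0_norm.
  have [|z _ fz] := @IVT R f x Y 0 xlY (wc _ _).
    by rewrite ge_min le_max (ltW fx0) (ltW fY) orbT.
  by have := f0 z; rewrite fz eqxx.
have [z _ zmin] := EVT_min YY (wc (- Y) Y).
exists (Num.min m (f z)); first by rewrite lt_min m0 fpos.
move=> x; rewrite ge_min.
have [xY|xY] := leP X `|x|; first by rewrite fm.
rewrite zmin ?orbT// in_itv/= -ler_norml.
exact: le_trans (ltW xY) XY.
Qed.

Lemma expR_decay_small (c k e : R) : 0 < k -> 0 < e ->
  exists X : R, forall (x a : R), X <= `|x| -> `|a| <= c * expR (- (k * `|x|)) -> `|a| <= e.
Proof.
(* As [expR t >= 1 + t], it suffices that [e * k * |x| >= |c|]. *)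
move=> k0 e0; exists (`|c| / e / k) => x a Xx /le_trans; apply.
apply: le_trans (ler_wpM2r (expR_ge0 _) (ler_norm c)) _.
rewrite expRN ler_pdivrMr ?expR_gt0//.
have := expR_ge1Dx (k * `|x|) => H.
apply: le_trans (_ : e * (1 + k * `|x|) <= _); last by rewrite ler_wpM2l// ltW.
rewrite mulrDr mulr1; apply: le_trans (_ : e * (k * `|x|) <= _); last by rewrite lerDr ltW.
move: Xx; rewrite !ler_pdivrMr// => /le_trans; apply.
by rewrite le_eqVlt; apply/orP; left; apply/eqP; ring.
Qed.

End LowerBound.

(** * Explicit diagonalization of the spatial matrix *)

Section SpatialMatrix.
Variable R : realType.
Local Notation C := (R[i]).

Lemma complex_ext (x y : C) :
  complex.Re x = complex.Re y -> complex.Im x = complex.Im y -> x = y.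
Proof. by case: x y => [a b] [c d] /= -> ->. Qed.

(* The spectral projections of [[0, -1], [1, 0]] for the eigenvalues
   i ([true]) and -i ([false]). *)
Definition rotproj (b : bool) : 'M[C]_2 :=
  let s : R := if b then 2^-1 else - 2^-1 in
  \matrix_(i < 2, j < 2)
    (if i == j then 2^-1 +i* 0 else if i == 0 then 0 +i* s else 0 -i* s)%C.

Lemma rotprojM a b : rotproj a *m rotproj b = if a == b then rotproj a else 0.
Proof.
by case: a; case: b; apply: mx2P; rewrite mulmx2E !mxE/=; apply: complex_ext => /=; field.
Qed.

Lemma rotprojD : rotproj true + rotproj false = 1%:M.
Proof. by apply: mx2P; rewrite !mxE/=; apply: complex_ext => /=; field. Qed.

Lemma cmx_cmat (a b : R) :
  cmx (cmat a b) = (a +i* b)%C *: rotproj true + (a -i* b)%C *: rotproj false.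
Proof. by apply: mx2P; rewrite !mxE/=; apply: complex_ext => /=; field. Qed.

Definition blk (a b c d : 'M[C]_2) : 'M[C]_4 := @block_mx C 2 2 2 2 a b c d.

Lemma blkM a b c d a' b' c' d' : blk a b c d *m blk a' b' c' d' =
  blk (a *m a' + b *m c') (a *m b' + b *m d')
      (c *m a' + d *m c') (c *m b' + d *m d').
Proof. exact: (@mulmx_block C 2 2 2 2 2 2). Qed.

Lemma blkD a b c d a' b' c' d' : blk a b c d + blk a' b' c' d' =
  blk (a + a') (b + b') (c + c') (d + d').
Proof. exact: (@add_block_mx C 2 2 2 2). Qed.

Lemma blkZ k a b c d : k *: blk a b c d = blk (k *: a) (k *: b) (k *: c) (k *: d).
Proof. exact: (@scale_block_mx C 2 2 2 2). Qed.

Lemma blk1 : blk 1%:M 0 0 1%:M = 1.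
Proof. by rewrite /blk -(@scalar_mx_block C 2 2). Qed.

Lemma blk0 : blk 0 0 0 0 = 0.
Proof. exact: (@block_mx0 C 2 2 2 2). Qed.

(** The Kronecker product of [[[x, y], [z, t]]] with [rotproj b]: for each [b], computations with
    4x4 matrices become 2x2 ones. *)
Definition rotblk (b : bool) (x y z t : C) : 'M[C]_4 :=
  blk (x *: rotproj b) (y *: rotproj b) (z *: rotproj b) (t *: rotproj b).

Lemma rotblkM a b x y z t x' y' z' t' :
  rotblk a x y z t *m rotblk b x' y' z' t' =
  if a == b then rotblk a (x * x' + y * z') (x * y' + y * t')
                          (z * x' + t * z') (z * y' + t * t') else 0.
Proof.
rewrite blkM -!scalemxAl -!scalemxAr !rotprojM; case: eqP => _.
  by rewrite !scalerA -!scalerDl.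
by rewrite !scaler0 !addr0 blk0.
Qed.

Lemma rotblkD b x y z t x' y' z' t' : rotblk b x y z t + rotblk b x' y' z' t' =
  rotblk b (x + x') (y + y') (z + z') (t + t').
Proof. by rewrite blkD -!scalerDl. Qed.

Lemma rotblkZ b k x y z t :
  k *: rotblk b x y z t = rotblk b (k * x) (k * y) (k * z) (k * t).
Proof. by rewrite blkZ !scalerA. Qed.

Lemma rotblk0 b : rotblk b 0 0 0 0 = 0.
Proof. by rewrite /rotblk scale0r blk0. Qed.

Variable kappa : bool -> C.
Hypothesis kappa0 : forall b, kappa b != 0.

(* [+- kappa b] are the eigenvalues of [[0, 1], [W, 0]], where [W] has the
   eigenvalues [kappa b ^+ 2]; the index [(true, b)] is the stable one. *)
Definition eigval (k : bool * bool) : C := (if k.1 then -1 else 1) * kappa k.2.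

(** The matrix [[[0, 1], [m^2, 0]]] has the spectral projection [[[1, 1/m], [m, 1]] / 2] for its
    eigenvalue [m]. *)
Definition eigproj (k : bool * bool) : 'M[C]_4 :=
  rotblk k.2 2%:R^-1 (2%:R * eigval k)^-1 (eigval k / 2%:R) 2%:R^-1.

Lemma sum_bool_pair (V : nmodType) (F : bool * bool -> V) :
  \sum_k F k = F (true, true) + F (false, true) + (F (true, false) + F (false, false)).
Proof.
rewrite (eq_bigr (fun k => F (k.1, k.2))); last by case.
rewrite -(pair_big xpredT xpredT (fun s b => F (s, b)))/= exchange_big/=.
by rewrite !big_bool.
Qed.

Lemma eigproj_resolution : spectral_resolution eigproj.
Proof.
split=> [[s a] [t b]|].
  rewrite /eigproj/= rotblkM xpair_eqE; case: eqP => [<-|_]; last by rewrite andbF.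
  rewrite andbT /eigval/=.
  case: s t => [] [] /=; rewrite -?[0 in RHS](rotblk0 a); congr rotblk;
    by field; rewrite ?kappa0.
have E b : eigproj (true, b) + eigproj (false, b) = rotblk b 1 0 0 1.
  by rewrite rotblkD /eigval/=; congr rotblk; field; rewrite ?kappa0.
rewrite sum_bool_pair.
transitivity (rotblk true 1 0 0 1 + rotblk false 1 0 0 1).
  by congr (_ + _); exact: E.
rewrite /rotblk blkD.
by rewrite !scale1r !scale0r !addr0 rotprojD blk1.
Qed.

Lemma eigproj_sum : \sum_k eigval k *: eigproj k =
  blk 0 1%:M (kappa true ^+ 2 *: rotproj true + kappa false ^+ 2 *: rotproj false) 0.
Proof.
have E b : eigval (true, b) *: eigproj (true, b) + eigval (false, b) *: eigproj (false, b)
    = rotblk b 0 1 (kappa b ^+ 2) 0.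
  rewrite !rotblkZ rotblkD /eigval/=.
  by congr rotblk; field; rewrite ?kappa0.
rewrite sum_bool_pair.
transitivity (rotblk true 0 1 (kappa true ^+ 2) 0 + rotblk false 0 1 (kappa false ^+ 2) 0).
  by congr (_ + _); exact: E.
rewrite /rotblk blkD.
by rewrite !scale1r !scale0r !addr0 rotprojD.
Qed.

End SpatialMatrix.

(** * Spatial eigenvalues off the essential spectrum *)

Section SpatialEigenvalues.
Variable R : realType.
Local Notation C := (R[i]).
Variables (D beta delta alpha : R) (lam : C).
Hypothesis Db : D != 0 \/ beta != 0.

Lemma Bm_norm_gt0 : 0 < beta ^+ 2 + (D / 2) ^+ 2.
Proof.
rewrite lt_def addr_ge0 ?sqr_ge0// andbT paddr_eq0 ?sqr_ge0// !sqrf_eq0.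
rewrite negb_and mulf_eq0 invr_eq0 pnatr_eq0 orbF.
by case: Db => ->; rewrite ?orbT.
Qed.

Lemma invmx_Bm : let n := beta ^+ 2 + (D / 2) ^+ 2 in
  invmx (Bm D beta) = cmat (beta / n) (- (D / 2) / n).
Proof.
move=> n; have n0 : n != 0 by rewrite gt_eqF// Bm_norm_gt0.
have BB : Bm D beta *m cmat (beta / n) (- (D / 2) / n) = 1%:M.
  have E : n = beta ^+ 2 + D ^+ 2 / 4 by rewrite /n; field.
  rewrite E in n0 *; have n0' : beta ^+ 2 * 4 + D ^+ 2 != 0.
    apply: contra n0 => /eqP H; rewrite -(mulIr_eq0 _ (mulIf (_ : 4 != 0 :> R)))//.
    by rewrite mulrDl divfK// H.
  by apply: mx2P; rewrite mulmx2E !mxE/=; field.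
have uB : Bm D beta \in unitmx by case/mulmx1_unit: BB.
by rewrite -[RHS](mulKmx uB) BB mulmx1.
Qed.

(** One of the two roots has positive real part unless both are imaginary, and then
    [w = - (Im k)^2]. *)
Lemma sqrt_stable (w : C) : (forall s : R, w != (- s ^+ 2)%:C%C) ->
  exists k : C, k ^+ 2 = w /\ 0 < complex.Re k.
Proof.
move=> Hw; have [k kw] : exists k : C, k ^+ 2 = w by exists (sqrtc w); exact: sqr_sqrtc.
have [k0|k0|k0] := ltgtP 0 (complex.Re k); first by exists k.
  by exists (- k); rewrite sqrrN; split=> //; case: k k0 {kw} => a b /=; rewrite oppr_gt0.
have := Hw (complex.Im k); rewrite -kw => /eqP[].
by case: k k0 {kw} => a b /= <-; apply: complex_ext => /=; rewrite ?expr2/=; ring.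
Qed.

(** [Bm] and [N0] are combinations of the two projections [rotproj], hence so is [W], with
    eigenvalues [wp] and [wm]. Either of them being [- s^2] would put [lam] on a curve of
    [sigma_ess]. *)
Lemma spatial_eigenvalues : ~ sigma_ess D beta delta alpha lam ->
  exists kappa : bool -> C, (forall b, 0 < complex.Re (kappa b)) /\
    Ainf D beta delta alpha lam =
    blk 0 1%:M (kappa true ^+ 2 *: rotproj R true + kappa false ^+ 2 *: rotproj R false) 0.
Proof.
move=> ess; have n0 := Bm_norm_gt0.
pose bp : C := (beta +i* (D / 2))%C; pose bm : C := (beta -i* (D / 2))%C.
have bp0 : bp != 0.
  by apply: contraTneq n0 => -[-> ->]; rewrite expr0n addr0 ltxx.
have bm0 : bm != 0.
  apply: contraTneq n0 => -[-> /eqP]; rewrite oppr_eq0 => /eqP ->.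
  by rewrite expr0n addr0 ltxx.
pose wp := (lam - (delta +i* alpha)%C) / bp; pose wm := (lam - (delta -i* alpha)%C) / bm.
have [kp [kp2 kp0]] : exists k : C, k ^+ 2 = wp /\ 0 < complex.Re k.
  apply: sqrt_stable => s; apply/eqP => E; apply: ess; exists s; left.
  have H : lam - (delta +i* alpha)%C = - (s ^+ 2)%:C%C * bp.
    by rewrite -[LHS](divfK bp0) -/wp E rmorphN.
  by rewrite -[LHS](subrK (delta +i* alpha)%C) H mulNr addrC.
have [km [km2 km0]] : exists k : C, k ^+ 2 = wm /\ 0 < complex.Re k.
  apply: sqrt_stable => s; apply/eqP => E; apply: ess; exists s; right.
  have H : lam - (delta -i* alpha)%C = - (s ^+ 2)%:C%C * bm.
    by rewrite -[LHS](divfK bm0) -/wm E rmorphN.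
  by rewrite -[LHS](subrK (delta -i* alpha)%C) H mulNr addrC.
exists (fun b => if b then kp else km); split; first by case.
rewrite /Ainf /blk; congr (@block_mx C 2 2 2 2); rewrite kp2 km2 invmx_Bm !cmx_cmat.
rewrite -scalemx1 -rotprojD scalerDr opprD addrACA -!scalerBl.
rewrite mulmxDl !mulmxDr -!scalemxAl -!scalemxAr !rotprojM/= !scaler0 addr0 add0r.
have n0' := gt_eqF n0.
have ip : bp^-1 = (beta / (beta ^+ 2 + (D / 2) ^+ 2) 
    +i* (- (D / 2) / (beta ^+ 2 + (D / 2) ^+ 2)))%C.
  by apply: complex_ext; rewrite /=  ?mulNr.
have im : bm^-1 = (beta / (beta ^+ 2 + (D / 2) ^+ 2) 
    -i* (- (D / 2) / (beta ^+ 2 + (D / 2) ^+ 2)))%C.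
  by apply: complex_ext; rewrite /= ?mulNr ?sqrrN.
by rewrite !scalerA -ip -im ![_^-1 * _]mulrC.
Qed.

End SpatialEigenvalues.

(** * Closed form of the kernel *)

Section KernelStructure.
Variable R : realType.
Local Notation C := (R[i]).

Lemma cvgn_sum (I : Type) (r : seq I) (f : I -> R^nat) :
  (forall k, cvgn (f k)) ->
  (fun N => \sum_(k <- r) f k N) @ \oo --> \sum_(k <- r) limn (f k).
Proof.
move=> fc; elim: r => [|k r IH].
  rewrite (_ : (fun _ => _) = cst 0); first by rewrite big_nil; exact: cvg_cst.
  by apply/funext => N; rewrite big_nil.
rewrite (_ : (fun _ => _) = (fun N => f k N + \sum_(l <- r) f l N)).
  by rewrite big_cons; apply: cvgD => //; exact: fc.
by apply/funext => N; rewrite big_cons.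
Qed.

Lemma Re_sum (J : Type) (r : seq J) (F : J -> C) :
  complex.Re (\sum_(l <- r) F l) = \sum_(l <- r) complex.Re (F l).
Proof.
elim: r => [|l r IH]; first by rewrite !big_nil.
by rewrite !big_cons -IH; case: (F l) => ? ?; case: (\sum_(_ <- _) _).
Qed.

(** Each entry of the partial sums is a combination of scalar exponential series; the weight [w] in
    [L] is 1 for the real part and [- 'i] for the imaginary part. *)
Lemma expmx_resolution n (I : finType) (mu : I -> C) (E : I -> 'M[C]_n.+1) :
  spectral_resolution E -> expmx (\sum_k mu k *: E k) = \sum_k cexp (mu k) *: E k.
Proof.
move=> HE; set A := \sum_k mu k *: E k.
have L (w : C) i j : limn (fun N => complex.Re (w * expmx_partial A N i j))
    = \sum_k exp_re (mu k) (w * E k i j) 1.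
  apply: cvg_lim => //.
  rewrite (_ : (fun _ => _) =
     (fun N => \sum_k pseries (exp_term (mu k) (w * E k i j)) 1 N)).
    by apply: cvgn_sum => k; exact: is_cvg_exp_term.
  apply/funext => N; rewrite /pseries /series/= exchange_big/= big_mkord.
  rewrite /expmx_partial summxE mulr_sumr Re_sum; apply: eq_bigr => m _.
  rewrite mxE resolution_exp// summxE !mulr_sumr Re_sum; apply: eq_bigr => k _.
  rewrite mxE /exp_term expr1n mulr1.
  have -> : (m`!%:R)^-1 = (m`!%:R^-1)%:C%C :> C by rewrite fmorphV rmorph_nat.
  rewrite mulrCA [mu k ^+ m * _]mulrC [w * (_ * _)]mulrA.
  by case: (w * E k i j * _) => p q /=; rewrite mul0r subr0 mulrC.
apply/matrixP => i j; rewrite mxE summxE.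
have ImN (z : C) : complex.Im z = complex.Re (- 'i%C * z).
  by case: z => a b /=; ring.
apply: complex_ext => /=.
- have := L 1 i j; under eq_fun do rewrite mul1r; move=> ->.
  by rewrite Re_sum; apply: eq_bigr => k _; rewrite mxE mul1r mulrC Re_mul_cexp.
- under eq_fun do rewrite ImN; rewrite L ImN mulr_sumr Re_sum.
  by apply: eq_bigr => k _; rewrite mxE [cexp _ * _]mulrC mulrA Re_mul_cexp.
Qed.

Variable kappa : bool -> C.
Hypothesis kappa_gt0 : forall b, 0 < complex.Re (kappa b).

(** The even Green's function of [W - d^2/dt^2]. *)
Definition resolvent_block (t : R) : 'M[C]_2 :=
  (cexp (`|t|%:C%C * - kappa true) / (2%:R * kappa true)) *: rotproj R true
  + (cexp (`|t|%:C%C * - kappa false) / (2%:R * kappa false)) *: rotproj R false.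

Let kappa0 b : kappa b != 0.
Proof. by apply: contraTneq (kappa_gt0 b) => ->; rewrite ltxx. Qed.

(** The outer factors select the upper right block, where the projections for [kappa b] and
    [- kappa b] have opposite signs; hence the differences of coefficients. *)
Lemma eigproj_sum_ur (S T : 'M[C]_2) (c : bool * bool -> C) :
  blk S 0 0 0 *m (\sum_k c k *: eigproj kappa k) *m blk 0 0 T 0 =
  blk (S *m (((c (false, true) - c (true, true)) / (2%:R * kappa true)) *: rotproj R true
           + ((c (false, false) - c (true, false)) / (2%:R * kappa false)) *: rotproj R false) *m T)
      0 0 0.
Proof.
have E b : c (true, b) *: eigproj kappa (true, b) + c (false, b) *: eigproj kappa (false, b)
    = rotblk b ((c (false, b) + c (true, b)) / 2%:R)
               ((c (false, b) - c (true, b)) / (2%:R * kappa b))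
               ((c (false, b) - c (true, b)) * kappa b / 2%:R)
               ((c (false, b) + c (true, b)) / 2%:R).
  rewrite !rotblkZ rotblkD /eigval/=.
  by congr rotblk; field; rewrite ?kappa0.
rewrite sum_bool_pair.
transitivity (blk S 0 0 0 *m (
   rotblk true ((c (false, true) + c (true, true)) / 2%:R)
               ((c (false, true) - c (true, true)) / (2%:R * kappa true))
               ((c (false, true) - c (true, true)) * kappa true / 2%:R)
               ((c (false, true) + c (true, true)) / 2%:R) +
   rotblk false ((c (false, false) + c (true, false)) / 2%:R)
               ((c (false, false) - c (true, false)) / (2%:R * kappa false))
               ((c (false, false) - c (true, false)) * kappa false / 2%:R)
               ((c (false, false) + c (true, false)) / 2%:R)) *m blk 0 0 T 0).
  by congr (_ *m _ *m _); congr (_ + _); exact: E.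
rewrite /rotblk blkD !blkM.
by rewrite !(mul0mx, mulmx0, addr0, add0r).
Qed.

Lemma eigval_stable k : (complex.Re (eigval kappa k) < 0) = k.1.
Proof.
case: k => s b; have := kappa_gt0 b; rewrite /eigval/=.
case: s; rewrite ?mulN1r ?mul1r; case: (kappa b) => p q /= p0.
  by rewrite oppr_lt0.
by apply/negbTE; rewrite -leNgt ltW.
Qed.

Lemma sandwich_resolution (p : pred (bool * bool)) (e : bool * bool -> C)
    (S T : 'M[C]_2) :
  let P := \sum_k (p k)%:R *: eigproj kappa k in
  blk S 0 0 0 *m P *m (\sum_k e k *: eigproj kappa k) *m P *m blk 0 0 T 0 =
  blk S 0 0 0 *m (\sum_k (if p k then e k else 0) *: eigproj kappa k) *m blk 0 0 T 0.
Proof.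
have res := eigproj_resolution kappa0.
move=> P; rewrite -[_ *m P *m _ *m P]mulmxA -[_ *m P *m _]mulmxA.
rewrite !resolution_mul//; congr (_ *m _ *m _).
by apply: eq_bigr => k _; case: (p k); rewrite ?mul1r ?mulr1 ?mul0r ?mulr0.
Qed.

(** The sign in front of the stable branch of the kernel cancels the one from the eigenvalue
    [- kappa b], so both branches take the same form. *)
Lemma sandwich_stable (S T : 'M[C]_2) (e : bool * bool -> C) :
  let Q := \sum_(k : bool * bool) (k.1 : bool)%:R *: eigproj kappa k in
  - (blk S 0 0 0 *m Q *m (\sum_k e k *: eigproj kappa k) *m Q *m blk 0 0 T 0) =
  blk (S *m ((e (true, true) / (2%:R * kappa true)) *: rotproj R true
           + (e (true, false) / (2%:R * kappa false)) *: rotproj R false) *m T) 0 0 0.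
Proof.
rewrite /= (sandwich_resolution (fun k => k.1)) eigproj_sum_ur /=.
rewrite -scaleN1r blkZ !scaler0; congr (blk _ 0 0 0).
rewrite !sub0r !mulNr !scaleNr -opprD mulmxN mulNmx.
by rewrite scale1r opprK.
Qed.

Lemma sandwich_unstable (S T : 'M[C]_2) (e : bool * bool -> C) :
  let Q := \sum_(k : bool * bool) (~~ k.1)%:R *: eigproj kappa k in
  blk S 0 0 0 *m Q *m (\sum_k e k *: eigproj kappa k) *m Q *m blk 0 0 T 0 =
  blk (S *m ((e (false, true) / (2%:R * kappa true)) *: rotproj R true
           + (e (false, false) / (2%:R * kappa false)) *: rotproj R false) *m T) 0 0 0.
Proof.
by rewrite /= (sandwich_resolution (fun k => ~~ k.1)) eigproj_sum_ur /= !subr0.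
Qed.

(** The exponents [- (x - y) kappa] for [y <= x] and [(x - y) kappa] for [x < y] are both
    [- |x - y| kappa], so the two branches merge into one formula. *)
Lemma Kker_blk D beta delta alpha eps gamma mu nu u v lam (x y : R) :
  Ainf D beta delta alpha lam =
    blk 0 1%:M (kappa true ^+ 2 *: rotproj R true + kappa false ^+ 2 *: rotproj R false) 0 ->
  Kker D beta delta alpha eps gamma mu nu u v lam x y =
  blk (cmx (psd_sqrt (mabs (Mm eps gamma mu nu u v x))) *m resolvent_block (x - y)
       *m cmx (- (invmx (Bm D beta) *m Mm eps gamma mu nu u v y
                  *m invmx (psd_sqrt (mabs (Mm eps gamma mu nu u v y))))))
    0 0 0.
Proof.
move=> AE; rewrite /Kker AE -(eigproj_sum kappa0).
have res := eigproj_resolution kappa0.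
have cardI : (#|{: bool * bool}| <= 4)%N by rewrite card_prod card_bool.
have QE : stable_proj (\sum_k eigval kappa k *: eigproj kappa k)
    = \sum_(k : bool * bool) (k.1 : bool)%:R *: eigproj kappa k.
  rewrite (stable_projE _ res cardI) big_mkcond; apply: eq_bigr => k _.
  by rewrite eigval_stable; case: k.1; rewrite ?scale1r ?scale0r.
have QcE : 1 - \sum_(k : bool * bool) (k.1 : bool)%:R *: eigproj kappa k
    = \sum_(k : bool * bool) (~~ k.1)%:R *: eigproj kappa k.
  rewrite -[in LHS]res.2 -sumrB; apply: eq_bigr => k _.
  by case: k.1; rewrite ?scale1r ?scale0r ?subrr ?subr0.
have EE t : expmx (t%:C%C *: \sum_k eigval kappa k *: eigproj kappa k)
    = \sum_k cexp (t%:C%C * eigval kappa k) *: eigproj kappa k.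
  rewrite -(expmx_resolution _ res) scaler_sumr; congr expmx.
  by apply: eq_bigr => k _; rewrite scalerA.
rewrite QE QcE EE; set S := cmx (psd_sqrt _); set T := cmx (- _).
have -> : Rr eps gamma mu nu u v x = blk S 0 0 0 by [].
have -> : Rl D beta eps gamma mu nu u v y = blk 0 0 T 0 by [].
pose e k := cexp ((x - y)%:C%C * eigval kappa k).
case: ifP => yx.
- apply: etrans (sandwich_stable S T e) _; rewrite /resolvent_block.
  have E b : e (true, b) = cexp (`|x - y|%:C%C * - kappa b).
    by rewrite /e /eigval/= mulN1r ger0_norm ?subr_ge0.
  by rewrite !E.
- apply: etrans (sandwich_unstable S T e) _; rewrite /resolvent_block.
  have E b : e (false, b) = cexp (`|x - y|%:C%C * - kappa b).
    rewrite /e /eigval/= mul1r ltr0_norm ?subr_lt0 ?ltNge ?yx//.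
    by rewrite rmorphN mulrNN.
  by rewrite !E.
Qed.

Lemma mxblip_resolvent_block :
  mxblip (fun x y : R => `|x - y|) resolvent_block.
Proof.
move=> i j.
have bl b : blip (fun x y : R => `|x - y|) (fun t => cexp (`|t|%:C%C * - kappa b)).
  apply: blip_cexp_abs; have := kappa_gt0 b.
  by case: (kappa b) => p q /= /ltW; rewrite oppr_le0.
have bt b := blipM (blipM (bl b) (blip_cst _ (2%:R * kappa b)^-1)) (blip_cst _ (rotproj R b i j)).
by apply: eq_blip (blipD (bt true) (bt false)) => t; rewrite /resolvent_block !mxE.
Qed.

End KernelStructure.

(** * Regularity of the pulse and of the factors of the potential *)

Lemma blip_derivable (R : realType) (f : R -> R) (K L : R) :
  (forall x, derivable f x 1) -> (forall x, `|f x| <= K) ->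
  (forall x, `|f^`() x| <= L) ->
  blip (fun x y : R => `|x - y|) (fun x => (f x)%:C%C).
Proof.
move=> df fK fL; apply: blip_realP fK _ => x y.
have fd t : is_derive t (1 : R) f (f^`() t).
  by rewrite derive1E; apply: derivableP; exact: df.
wlog xy : x y / x <= y.
  by move=> H; case: (leP x y) => [|/ltW] /H//; rewrite distrC (distrC y).
rewrite distrC (distrC x) (ger0_norm (_ : 0 <= y - x)) ?subr_ge0//.
by apply: MVT_bound xy fd _ => t _; exact: fL.
Qed.

Section PulseLipschitz.
Variable R : realType.
Local Notation C := (R[i]).
Variables (eps gamma mu nu : R) (u v : R -> R) (c k : R).
Let dist (x y : R) := `|x - y|.
Hypothesis k_gt0 : 0 < k.
Hypothesis u_decay : forall x, `|u x| <= c * expR (- (k * `|x|)).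
Hypothesis v_decay : forall x, `|v x| <= c * expR (- (k * `|x|)).
Hypothesis u_lip : blip dist (fun x => (u x)%:C%C).
Hypothesis v_lip : blip dist (fun x => (v x)%:C%C).
Hypothesis u_cont : continuous u.
Hypothesis v_cont : continuous v.
Hypothesis det_neq0 : forall x, \det (Mm eps gamma mu nu u v x) != 0.

Let n1 : C := (eps +i* gamma)%C.
Let n2 : C := (mu +i* nu)%C.
Let Psi (x : R) : C := (u x +i* v x)%C.
Let r := psinorm2 u v.
Let p x := 3 * (eps ^+ 2 + gamma ^+ 2) + 8 * (eps * mu + gamma * nu) * r x
  + 5 * (mu ^+ 2 + nu ^+ 2) * r x ^+ 2.

Let p_neq0 x : p x != 0.
Proof.
by have := det_neq0 x; rewrite det_Mm -/r -/(p x) mulf_eq0 negb_or => /andP[].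
Qed.

Let r_gt0 x : 0 < r x.
Proof.
have := det_neq0 x; rewrite det_Mm -/r mulf_eq0 negb_or expf_eq0/= => /andP[r0 _].
by rewrite lt_def r0 addr_ge0// sqr_ge0.
Qed.

Let p_lower_bound : eps ^+ 2 + gamma ^+ 2 != 0 ->
  exists2 m, 0 < m & forall x, m <= p x.
Proof.
set N := _ + _ => N0.
have {N0} N0 : 0 < N by rewrite lt_def N0 addr_ge0// sqr_ge0.
pose q := eps * mu + gamma * nu.
have q1 : 0 < 16 * `|q| + 1 by rewrite ltr_wpDl// mulr_ge0.
(* If [|u|] and [|v|] are at most [e], then [8 |q| r <= N], so [p >= 3 N - N >= N]. The added 1
   keeps the denominator positive when [q = 0]. *)
pose e := Num.sqrt (N / (16 * `|q| + 1)).
have e0 : 0 < e by rewrite sqrtr_gt0 divr_gt0.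
have [X HX] := @expR_decay_small R c k e k_gt0 e0.
have cr : continuous r.
  have -> : r = (fun x => u x * u x + v x * v x).
    by apply/funext => x; rewrite /r /psinorm2 !expr2.
  move=> x; apply: cvgD; apply: cvgM;
    solve [exact: u_cont | exact: v_cont].
apply: (@continuous_neq0_lower_bound R p X N) => //.
  have -> : p = (fun x => 3 * N + 8 * q * r x + 5 * (mu ^+ 2 + nu ^+ 2) * (r x * r x)).
    by apply/funext => x; rewrite /p expr2.
  move=> x; apply: cvgD; [apply: cvgD|].
  - exact: cvg_cst.
  - by apply: cvgM; [exact: cvg_cst|exact: cr].
  - by apply: cvgM; [exact: cvg_cst|apply: cvgM; exact: cr].
move=> x Xx.
have sq (a : R) : `|a| <= e -> a ^+ 2 <= N / (16 * `|q| + 1).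
  move=> ae; rewrite -[leRHS]sqr_sqrtr; last by rewrite divr_ge0// ltW.
  by rewrite -real_normK ?num_real// ler_pXn2r ?nnegrE// ltW.
have ru := sq _ (HX _ _ Xx (u_decay x)); have rv := sq _ (HX _ _ Xx (v_decay x)).
have rN : r x * (16 * `|q| + 1) <= 2 * N.
  rewrite -ler_pdivlMr// -mulrA /r /psinorm2; lra.
have rx := ltW (r_gt0 x).
have qr : - (`|q| * r x) <= q * r x.
  by rewrite -mulNr ler_wpM2r// lerNl -normrN ler_norm.
have mr : 0 <= (mu ^+ 2 + nu ^+ 2) * r x ^+ 2.
  by rewrite mulr_ge0 ?sqr_ge0// addr_ge0 ?sqr_ge0.
rewrite /p -/N -/q; lra.
Qed.

Lemma mxblip_potential :
  mxblip dist (fun x => cmx (psd_sqrt (mabs (Mm eps gamma mu nu u v x)))) /\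
  mxblip dist (fun x => cmx (Mm eps gamma mu nu u v x
     *m invmx (psd_sqrt (mabs (Mm eps gamma mu nu u v x))))).
Proof.
have bPsi : blip dist Psi by exact: blip_ReIm.
have nPsi x : normc (Psi x) ^+ 2 = r x by rewrite /= sqr_sqrtr// ltW// r_gt0.
have Psi0 x : Psi x != 0.
  apply: contraTneq (r_gt0 x) => Px0.
  by rewrite -nPsi Px0 normc0 expr0n ltxx.
have br : blip dist (fun x => (r x)%:C%C).
  apply: eq_blip (blipM (blip_normc bPsi) (blip_normc bPsi)) => x.
  by rewrite -nPsi rmorphXn expr2.
have rC x : (r x)%:C%C = Psi x * (Psi x)^*%C.
  by apply: complex_ext; rewrite /r /psinorm2/=; ring.
have rC0 x : (r x)%:C%C != 0 :> C by rewrite fmorph_eq0 gt_eqF// r_gt0.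
have PsiJ x : (Psi x)^*%C != 0 by rewrite conjc_eq0.
have he x : (Psi x ^+ 2 / (r x)%:C%C) * (Psi x ^+ 2 / (r x)%:C%C)^*%C = 1.
  have -> : (Psi x ^+ 2 / (r x)%:C%C)^*%C = (Psi x)^*%C ^+ 2 / (r x)%:C%C.
    have JM (z t : C) : (z * t)^*%C = z^*%C * t^*%C by exact: rmorphM.
    by rewrite !JM conjc_inv conjc_real.
  by rewrite rC; field; rewrite Psi0 PsiJ.
have RX (a : R) : (a ^+ 2)%:C%C = a%:C%C ^+ 2 :> C by exact: rmorphXn.
have R2 : 2%:C%C = 2%:R :> C by exact: rmorph_nat.
have R3 : 3%:C%C = 3%:R :> C by exact: rmorph_nat.
have [N0|/p_lower_bound[m m0 pm]] := eqVneq (eps ^+ 2 + gamma ^+ 2) 0.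
(* Case [n1 = 0]: the weight is [r], its product with the phase is [Psi^2], and [al], [b] are
   constant. The bound [5 |n2|^2] is positive because [p 0 != 0]. *)
- move: N0 => /eqP; rewrite paddr_eq0 ?sqr_ge0// !sqrf_eq0 => /andP[/eqP e0 /eqP g0].
  have mn : 0 < 5 * (mu ^+ 2 + nu ^+ 2).
    have := p_neq0 0; rewrite /p e0 g0 => H.
    rewrite mulr_gt0// lt_def addr_ge0 ?sqr_ge0// andbT.
    by apply: contra H => /eqP ->; apply/eqP; ring.
  apply: (@mxblip_polar R R dist r (fun=> 3%:C%C * n2) (fun=> 2%:C%C * n2)
    (fun x => Psi x ^+ 2 / (r x)%:C%C) _ _ mn r_gt0 he) => //.
  + move=> x; rewrite !normcM !exprMn !normcR !normr_nat.
    rewrite /= sqr_sqrtr ?addr_ge0 ?sqr_ge0//; lra.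
  + apply: eq_blip (blipM bPsi bPsi) => x.
    by rewrite [RHS]mulrC divfK// expr2.
  + exact: blip_cst.
  + exact: blip_cst.
  + move=> x; rewrite Mm_rlin -/r -/n2 -/(Psi x) e0 g0 -[(0 +i* 0)%C]/(0 : C) !mulr0 !add0r.
    by rewrite R2 R3; congr rlin; rewrite RX; field; rewrite ?rC0.
(* Case [n1 <> 0]: the weight is [|Psi|], its product with the phase is [Psi^2 / |Psi|], and
   [|al|^2 - |b|^2] is [p]. *)
- pose w x := normc (Psi x).
  have w0 x : 0 < w x.
    by rewrite lt_def normc_ge0 andbT; apply: contra (Psi0 x) => /eqP/eq0_normc ->.
  have wC0 x : (w x)%:C%C != 0 :> C by rewrite fmorph_eq0 gt_eqF.
  have rw x : (r x)%:C%C = (w x)%:C%C ^+ 2 :> C by rewrite -rmorphXn nPsi.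
  have bal (a b : R) : blip dist (fun x => a%:C%C * n1 + b%:C%C * (r x)%:C%C * n2).
    by do ?[apply: blipD|apply: blipM|exact: blip_cst].
  apply: (@mxblip_polar R R dist w (fun x => 2%:C%C * n1 + 3%:C%C * (r x)%:C%C * n2)
    (fun x => 1%:C%C * n1 + 2%:C%C * (r x)%:C%C * n2) (fun x => Psi x ^+ 2 / (r x)%:C%C)
    _ _ m0 w0 he).
  + move=> x; apply: le_trans (pm x) _; rewrite le_eqVlt; apply/orP; left; apply/eqP.
    rewrite /= !sqr_sqrtr ?addr_ge0 ?sqr_ge0// /p; ring.
  + exact: blip_normc.
  + apply: eq_blip (blip_sqr_div_normc Psi0 bPsi) => x.
    by rewrite rw -/(w x); field; exact: wC0.
  + exact: bal.
  + exact: bal.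
  + move=> x; rewrite Mm_rlin -/r -/n1 -/n2 -/(Psi x) R2 R3 mul1r.
    by congr rlin; rewrite RX rw; field; do ?exact: wC0.
Qed.

End PulseLipschitz.

(** * Assembly of the kernel estimate *)

Lemma mxblip_blk (R : realType) (T : Type) (d : T -> T -> R) (F : T -> 'M[R[i]]_2) :
  mxblip d F -> mxblip d (fun x => blk (F x) 0 0 0).
Proof.
move=> HF i j; have bl0 := blip_cst d (0 : R[i]).
case: (@split_ordP 2 2 i) => i' ->; case: (@split_ordP 2 2 j) => j' ->.
- by apply: eq_blip (HF i' j') => x; rewrite /blk (@block_mxEul _ 2 2 2 2).
- by apply: eq_blip bl0 => x; rewrite /blk (@block_mxEur _ 2 2 2 2) mxE.
- by apply: eq_blip bl0 => x; rewrite /blk (@block_mxEdl _ 2 2 2 2) mxE.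
- by apply: eq_blip bl0 => x; rewrite /blk (@block_mxEdr _ 2 2 2 2) mxE.
Qed.

Unset Implicit Arguments.

Theorem theorem7p3 (R : realType) (D beta delta alpha eps gamma mu nu : R)
    (u v : R -> R) (lam : R[i]) :
  0 <= beta -> (D != 0 \/ beta != 0) ->
  pulse_eq D beta delta alpha eps gamma mu nu u v ->
  ~ sigma_ess D beta delta alpha lam ->
  (* psi in C^1(R, R^2) *)
  (forall x, derivable u x 1 /\ derivable v x 1) ->
  continuous (u^`()) -> continuous (v^`()) ->
  (* psi and psi_x decay exponentially as |x| -> oo *)
  (exists (c k : R), 0 < k /\ forall x,
      `|u x| <= c * expR (- (k * `|x|)) /\ `|v x| <= c * expR (- (k * `|x|)) /\
      `|u^`() x| <= c * expR (- (k * `|x|)) /\ `|v^`() x| <= c * expR (- (k * `|x|))) ->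
  (forall x, \det (Mm eps gamma mu nu u v x) != 0) ->
  exists L : R, forall (x y x' y' : R) (i j : 'I_4),
    cabs (Kker D beta delta alpha eps gamma mu nu u v lam x y i j
          - Kker D beta delta alpha eps gamma mu nu u v lam x' y' i j)
    <= L * (`|x - x'| + `|y - y'|).
Proof.
move=> _ Db _ ess duv _ _ [c [k [k0 decay]]] det0.
have [kappa [kappa0 AE]] := spatial_eigenvalues Db ess.
(* Each exponential bound yields the uniform bound [|c|]; applied to the derivatives, it makes [u]
   and [v] Lipschitz. *)
have cb (x a : R) : `|a| <= c * expR (- (k * `|x|)) -> `|a| <= `|c|.
  move/le_trans; apply; apply: le_trans (ler_wpM2r (expR_ge0 _) (ler_norm c)) _.
  by rewrite ler_piMr// -expR0 ler_expR oppr_le0 mulr_ge0// ltW.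
have bu := blip_derivable (fun x => (duv x).1) (fun x => cb x _ (decay x).1)
  (fun x => cb x _ (decay x).2.2.1).
have bv := blip_derivable (fun x => (duv x).2) (fun x => cb x _ (decay x).2.1)
  (fun x => cb x _ (decay x).2.2.2).
have cont (f : R -> R) : (forall x, derivable f x 1) -> continuous f.
  by move=> df x; apply: differentiable_continuous; apply/derivable1_diffP.
have [bS bV] := mxblip_potential k0 (fun x => (decay x).1) (fun x => (decay x).2.1) bu bv
  (cont _ (fun x => (duv x).1)) (cont _ (fun x => (duv x).2)) det0.
pose d2 (s t : R * R) := `|s.1 - t.1| + `|s.2 - t.2|.
have lift2 m n (F : R -> 'M[R[i]]_(m, n)) (h : R * R -> R) :
    mxblip (fun x y : R => `|x - y|) F ->
    (forall s t, `|h s - h t| <= 1 * d2 s t) -> mxblip d2 (fun s => F (h s)).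
  move=> bF hd i j; exact: (@blip_comp R (R * R) R _ d2 (fun x => F x i j) h 1
    ler01 (fun _ _ => normr_ge0 _) hd (bF i j)).
have bK : mxblip d2 (fun s => Kker D beta delta alpha eps gamma mu nu u v lam s.1 s.2).
  (* The constant factor [- B^-1] is split off, leaving [M |M|^(-1/2)], which [bV] covers. *)
  have -> : (fun s => Kker D beta delta alpha eps gamma mu nu u v lam s.1 s.2) =
      (fun s : R * R => blk (cmx (psd_sqrt (mabs (Mm eps gamma mu nu u v s.1)))
         *m resolvent_block kappa (s.1 - s.2)
         *m (cmx (- invmx (Bm D beta)) *m cmx (Mm eps gamma mu nu u v s.2
                  *m invmx (psd_sqrt (mabs (Mm eps gamma mu nu u v s.2)))))) 0 0 0).
    apply/funext => s; rewrite (Kker_blk kappa0 _ _ _ _ _ _ _ _ AE).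
    by rewrite /cmx -map_mxM mulNmx mulmxA.
  apply: mxblip_blk; apply: mxblipM; [apply: mxblipM|apply: mxblipM].
  - by apply: (lift2 _ _ _ fst bS) => s t; rewrite mul1r lerDl.
  - apply: (lift2 _ _ _ (fun s => s.1 - s.2) (mxblip_resolvent_block kappa0)) => s t.
    rewrite mul1r (_ : _ - _ = (s.1 - t.1) - (s.2 - t.2)); last by ring.
    exact: ler_normB.
  - by move=> i j; exact: blip_cst.
  - by apply: (lift2 _ _ _ snd bV) => s t; rewrite mul1r lerDr.
have /choice[L HL] : forall ij : 'I_4 * 'I_4, exists L : R, forall s t : R * R,
    normc (Kker D beta delta alpha eps gamma mu nu u v lam s.1 s.2 ij.1 ij.2
         - Kker D beta delta alpha eps gamma mu nu u v lam t.1 t.2 ij.1 ij.2) <= L * d2 s t.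
  by move=> [i j]; have [_ [L [_ HL]]] := bK i j; exists L.
(* Each entry comes with its own constant; the sum of their absolute values serves all entries. *)
exists (\sum_ij `|L ij|) => x y x' y' i j.
have -> z : cabs z = normc z by case: z.
apply: le_trans (HL (i, j) (x, y) (x', y')) _.
apply: ler_wpM2r; first by rewrite addr_ge0.
apply: le_trans (ler_norm _) _.
by rewrite (bigD1 (i, j))//= lerDl sumr_ge0.
Qed.
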